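(* Let $X_1,\dots,X_n$ be independent random variables with values in $\mathbb{Z}_+$, and suppose that for each $i$ the probability generating function $M_{X_i}$ satisfies $G_{X_i}(z):=M_{X_i}'(z)/M_{X_i}(z)=\sum_{m=0}^\infty a_{i,m+1}z^m$. Let $Y=\sum_{i=1}^nX_i$ and $$\mu=\sum_{i=1}^n\sum_{m\ge0}a_{i,m+1},\quad \sigma^2=\sum_{i=1}^n\sum_{m\ge0}(m+1)a_{i,m+1},\quad \mu_2=\sum_{i=1}^n\sum_{m\ge0}m\,a_{i,m+1}.$$ Assume $\sigma^2>\mu$, set $p=\mu/\sigma^2$, $q=1-p$, $\alpha=\mu^2/\mu_2$, and let $Z\sim\mathrm{NB}(\alpha,p)$. Then $$d_{TV}(Y,Z)\le\frac{1}{\alpha q}\sqrt{\frac{2}{\pi}}\Bigl(\frac14+\sum_{i=1}^n\bigl(1-d_{TV}(X_i,X_i+1)\bigr)\Bigr)^{-1/2}\sum_{i=1}^n\sum_{l=1}^\infty l(l-1)\bigl|a_{i,l+1}-q\,a_{i,l}\bigr| .$$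
   Context: $\mathrm{NB}(\alpha,p)$: $\mathbf{P}(Z=m)=\binom{\alpha+m-1}{m}p^\alpha q^m$, $m\ge0$. $d_{TV}(Y,X)=\frac12\sum_{m\ge0}|\mathbf{P}(Y=m)-\mathbf{P}(X=m)|$; $X_i+1$ denotes the shifted random variable. The parameters $\alpha,p$ match the mean $\mu$ and variance $\sigma^2$ of $Y$. *)

(* Defs.v *)
From Stdlib Require Import Reals Lra List Factorial.
From Coquelicot Require Export Coquelicot.
Export ListNotations.
Open Scope R_scope.

Definition fsum (n : nat) (F : nat -> R) : R :=
  fold_right Rplus 0 (map F (seq 0 n)).

(* A law on Z_+ is represented by its probability mass function nat -> R. *)

Definition conv (f g : nat -> R) (m : nat) : R :=
  fsum (S m) (fun k => f k * g (m - k)%nat).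

Definition delta0 (m : nat) : R := if Nat.eqb m 0 then 1 else 0.

(* Law of X_0 + ... + X_{n-1} for independent X_i with pmfs f i. *)
Fixpoint law_sum (f : nat -> nat -> R) (n : nat) : nat -> R :=
  match n with
  | O => delta0
  | S k => conv (law_sum f k) (f k)
  end.

Definition pgf (f : nat -> R) (z : R) : R := Series (fun m => f m * z ^ m).

Definition dTV (f g : nat -> R) : R :=
  / 2 * Series (fun m => Rabs (f m - g m)).

Definition shift1 (f : nat -> R) (m : nat) : R :=
  match m with O => 0 | S k => f k end.

(* Generalized binomial coefficient binom(a+m-1, m) = a(a+1)...(a+m-1)/m!. *)
Definition gbinom (a : R) (m : nat) : R :=
  fold_right Rmult 1 (map (fun j => a + INR j) (seq 0 m)) / INR (Factorial.fact m).

Definition nb_pmf (alpha p : R) (m : nat) : R :=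
  gbinom alpha m * Rpower p alpha * (1 - p) ^ m.

(* Main.v *)
Require Import Defs.
From Stdlib Require Import Reals Lra Lia Psatz ZArith List.
From Coquelicot Require Import Coquelicot.
Open Scope R_scope.

(** Writing [h] for the law of [Y] and [A_k] for the sum of the [a_{i,k}], the
    logarithmic derivative of the generating function gives
    [E[Y g(Y)] = sum_k A_{k+1} E[g(Y+k+1)]].  For the bounded solution [g] of the
    negative binomial Stein equation [q(alpha+k) g(k+1) - k g(k) = 1_B(k) - P(Z in B)]
    this turns [P(Y in B) - P(Z in B)] into a combination of the [E[g(Y+k+1)]] whose
    coefficients are annihilated by constants and, by the matching of the two moments,
    by linear functions.  Hence only second differences of [k -> E[g(Y+k+1)]] matter;
    they are at most [2 d_TV(Y,Y+1) sup |g(k+1) - g(k)|], and the supremum is at most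
    [1/(alpha q)].

    It remains to show [d_TV(Y,Y+1) <= sqrt(2/pi) (1/4 + s)^(-1/2)] with
    [s = sum_i (1 - d_TV(X_i,X_i+1))].  A layer-cake decomposition writes each law as a
    mixture of uniform laws on intervals, a [k]-point interval having
    [1 - d_TV = 1 - 1/k].  Sums of independent uniforms are symmetric unimodal, so that
    [d_TV(K,K+1)] is the maximal atom of [K], which Fourier inversion bounds by
    [(1/pi) int_0^pi prod_j |D_{k_j}(v)|/k_j dv].  Since
    [|D_k(v)|/k <= 1 - (1 - 1/k) sin^2 v] is affine in [1 - 1/k], averaging over the
    mixture gives [d_TV(Y,Y+1) <= (1/pi) int_0^pi exp(-s sin^2 v) dv], and
    [exp(-y) <= (1 + y/3)^(-3)] makes the integral explicit. *)

(** * Finite sums and convolutions *)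

Lemma fsum_S n F : fsum (S n) F = fsum n F + F n.
Proof.
  unfold fsum. rewrite seq_S, map_app, fold_right_app. simpl. rewrite Rplus_0_r.
  generalize (F n). induction (map F (seq 0 n)) as [|x l IH]; intros y; simpl.
  - lra.
  - rewrite IH. lra.
Qed.

Lemma fsum_ext n F G : (forall i, (i < n)%nat -> F i = G i) -> fsum n F = fsum n G.
Proof.
  induction n as [|n IH]; intros H; [reflexivity|].
  rewrite !fsum_S, H, IH by auto with arith. reflexivity.
Qed.

Lemma fsum_le n F G : (forall i, (i < n)%nat -> F i <= G i) -> fsum n F <= fsum n G.
Proof.
  induction n as [|n IH]; intros H; [apply Rle_refl|].
  rewrite !fsum_S. apply Rplus_le_compat; auto with arith.
Qed.

Lemma fsum_0 n F : (forall i, (i < n)%nat -> F i = 0) -> fsum n F = 0.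
Proof.
  induction n as [|n IH]; intros H; [reflexivity|].
  rewrite fsum_S, H, IH by auto with arith. lra.
Qed.

Lemma fsum_nonneg n F : (forall i, (i < n)%nat -> 0 <= F i) -> 0 <= fsum n F.
Proof.
  intros H. rewrite <- (fsum_0 n (fun _ => 0)) by reflexivity. now apply fsum_le.
Qed.

Lemma fsum_const n c : fsum n (fun _ => c) = INR n * c.
Proof.
  induction n as [|n IH]; [unfold fsum; simpl; ring|]. rewrite fsum_S, S_INR, IH. ring.
Qed.

Lemma fsum_plus n F G : fsum n (fun i => F i + G i) = fsum n F + fsum n G.
Proof.
  induction n as [|n IH]; [unfold fsum; simpl; lra|]. rewrite !fsum_S, IH. lra.
Qed.

Lemma fsum_scal n c F : fsum n (fun i => c * F i) = c * fsum n F.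
Proof.
  induction n as [|n IH]; [unfold fsum; simpl; lra|]. rewrite !fsum_S, IH. lra.
Qed.

Lemma fsum_minus n F G : fsum n (fun i => F i - G i) = fsum n F - fsum n G.
Proof.
  induction n as [|n IH]; [unfold fsum; simpl; lra|]. rewrite !fsum_S, IH. lra.
Qed.

Lemma fsum_abs n F : Rabs (fsum n F) <= fsum n (fun i => Rabs (F i)).
Proof.
  induction n as [|n IH]; [unfold fsum; simpl; rewrite Rabs_R0; lra|].
  rewrite !fsum_S. eapply Rle_trans; [apply Rabs_triang|]. lra.
Qed.

Lemma fsum_add n m F : fsum (n + m) F = fsum n F + fsum m (fun i => F (n + i)%nat).
Proof.
  induction m as [|m IH]; [rewrite Nat.add_0_r; unfold fsum at 3; simpl; lra|].
  rewrite Nat.add_succ_r, !fsum_S, IH. lra.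
Qed.

Lemma fsum_Sl n F : fsum (S n) F = F 0%nat + fsum n (fun i => F (S i)).
Proof.
  change (S n) with (1 + n)%nat. rewrite fsum_add. unfold fsum at 1. simpl. lra.
Qed.

Lemma fsum_rev n F : fsum n F = fsum n (fun i => F (n - 1 - i)%nat).
Proof.
  induction n as [|n IH]; [reflexivity|].
  rewrite fsum_S, IH, fsum_Sl. replace (S n - 1 - 0)%nat with n by lia.
  rewrite Rplus_comm. f_equal. apply fsum_ext; intros i Hi. f_equal; lia.
Qed.

Lemma fsum_swap n m (F : nat -> nat -> R) :
  fsum n (fun i => fsum m (F i)) = fsum m (fun j => fsum n (fun i => F i j)).
Proof.
  induction n as [|n IH].
  - symmetry; apply fsum_0; reflexivity.
  - rewrite fsum_S, IH, <- fsum_plus. apply fsum_ext; intros; now rewrite fsum_S.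
Qed.

(** Both sides run over the triangle [k + j < n], by antidiagonals and by rows. Associativity of
    [conv] and the partial-sum computations for convolutions rest on it. *)
Lemma fsum_triangle n (F : nat -> nat -> R) :
  fsum n (fun m => fsum (S m) (fun k => F k (m - k)%nat)) =
  fsum n (fun k => fsum (n - k) (F k)).
Proof.
  induction n as [|n IH]; [reflexivity|].
  rewrite (fsum_S n), IH, (fsum_S n (fun k => fsum (S n - k) (F k))).
  replace (S n - n)%nat with 1%nat by lia.
  rewrite (fsum_S n (fun k => F k (n - k)%nat)), Nat.sub_diag.
  replace (fsum 1 (F n)) with (F n 0%nat) by (unfold fsum; simpl; lra).
  rewrite <- Rplus_assoc. f_equal. rewrite <- fsum_plus.
  apply fsum_ext; intros k Hk.
  rewrite Nat.sub_succ_l by lia. now rewrite fsum_S.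
Qed.

Lemma sum_n_fsum F n : sum_n F n = fsum (S n) F.
Proof.
  induction n as [|n IH].
  - rewrite sum_O. unfold fsum; simpl. lra.
  - rewrite sum_Sn, IH, (fsum_S (S n)). reflexivity.
Qed.

Lemma is_series_fsum F l : is_series F l <-> is_lim_seq (fun n => fsum n F) l.
Proof.
  split; intros H.
  - apply is_lim_seq_incr_1.
    apply (is_lim_seq_ext (sum_n F)); [intros; apply sum_n_fsum|exact H].
  - apply is_lim_seq_incr_1 in H.
    apply (is_lim_seq_ext _ (sum_n F)) in H; [exact H|intros; now rewrite sum_n_fsum].
Qed.

Lemma conv_ext f f' g g' m :
  (forall k, (k <= m)%nat -> f k = f' k) -> (forall k, (k <= m)%nat -> g k = g' k) ->
  conv f g m = conv f' g' m.
Proof.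
  intros Hf Hg. apply fsum_ext; intros k Hk. rewrite Hf, Hg by lia. reflexivity.
Qed.

Lemma conv_comm f g m : conv f g m = conv g f m.
Proof.
  unfold conv. rewrite fsum_rev. apply fsum_ext; intros k Hk.
  replace (m - (S m - 1 - k))%nat with k by lia.
  replace (S m - 1 - k)%nat with (m - k)%nat by lia. ring.
Qed.

Lemma conv_plus_l f f' g m :
  conv (fun k => f k + f' k) g m = conv f g m + conv f' g m.
Proof.
  unfold conv. rewrite <- fsum_plus. apply fsum_ext; intros; ring.
Qed.

Lemma conv_plus_r f g g' m :
  conv f (fun k => g k + g' k) m = conv f g m + conv f g' m.
Proof.
  unfold conv. rewrite <- fsum_plus. apply fsum_ext; intros; ring.
Qed.

Lemma conv_scal_l c f g m : conv (fun k => c * f k) g m = c * conv f g m.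
Proof.
  unfold conv. rewrite <- fsum_scal. apply fsum_ext; intros; ring.
Qed.

Lemma conv_scal_r c f g m : conv f (fun k => c * g k) m = c * conv f g m.
Proof.
  unfold conv. rewrite <- fsum_scal. apply fsum_ext; intros; ring.
Qed.

Lemma conv_assoc f g h m : conv (conv f g) h m = conv f (conv g h) m.
Proof.
  pose (F := fun k j => f k * g j * h (m - (k + j))%nat).
  transitivity (fsum (S m) (fun l => fsum (S l) (fun k => F k (l - k)%nat))).
  - unfold conv. apply fsum_ext; intros l Hl. rewrite Rmult_comm, <- fsum_scal.
    apply fsum_ext; intros k Hk. unfold F. replace (k + (l - k))%nat with l by lia. ring.
  - rewrite fsum_triangle. unfold conv. apply fsum_ext; intros k Hk.
    rewrite Nat.sub_succ_l by lia. rewrite <- fsum_scal.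
    apply fsum_ext; intros j Hj. unfold F. replace (m - (k + j))%nat with (m - k - j)%nat by lia. ring.
Qed.

Lemma conv_delta0_r f m : conv f delta0 m = f m.
Proof.
  unfold conv. rewrite fsum_S, Nat.sub_diag, fsum_0.
  - unfold delta0; simpl; ring.
  - intros i Hi. unfold delta0. destruct (Nat.eqb_spec (m - i) 0); [lia|ring].
Qed.

Lemma conv_nonneg f g m :
  (forall k, 0 <= f k) -> (forall k, 0 <= g k) -> 0 <= conv f g m.
Proof.
  intros Hf Hg. apply fsum_nonneg; intros; now apply Rmult_le_pos.
Qed.

(** * The Dirichlet kernel *)

(** The kernel [sin (k v) / sin v]: [k] times the characteristic function at [2 v] of the centred
    uniform law on [k] points. The cosine sum also covers the zeros of [sin]. *)
Definition dirichlet (k : nat) (v : R) : R :=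
  fsum k (fun j => cos ((INR k - 1 - 2 * INR j) * v)).

(** Telescoping of [2 cos x sin v = sin (x + v) - sin (x - v)] along arguments spaced by [2 v]. *)
Lemma fsum_cos_sin m c v :
  2 * (fsum m (fun j => cos ((c - 2 * INR j) * v)) * sin v) =
  sin ((c + 1) * v) - sin ((c + 1 - 2 * INR m) * v).
Proof.
  induction m as [|m IH].
  - unfold fsum; simpl. replace (c + 1 - 2 * 0) with (c + 1) by ring. ring.
  - rewrite fsum_S, Rmult_plus_distr_r, Rmult_plus_distr_l, IH, S_INR.
    replace ((c + 1 - 2 * INR m) * v) with ((c - 2 * INR m) * v + v) by ring.
    replace ((c + 1 - 2 * (INR m + 1)) * v) with ((c - 2 * INR m) * v - v) by ring.
    rewrite sin_plus, sin_minus. ring.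
Qed.

(** Reversing the order of summation flips the sign of every argument. *)
Lemma fsum_sin_antisym k v :
  fsum k (fun j => sin ((INR k - 1 - 2 * INR j) * v)) = 0.
Proof.
  set (s := fsum _ _). enough (s = - s) by lra.
  unfold s at 1. rewrite fsum_rev.
  transitivity (fsum k (fun j => - 1 * sin ((INR k - 1 - 2 * INR j) * v))).
  - apply fsum_ext; intros i Hi.
    replace (k - 1 - i)%nat with (k - S i)%nat by lia.
    rewrite minus_INR, S_INR by lia.
    replace ((INR k - 1 - 2 * (INR k - (INR i + 1))) * v)
      with (- ((INR k - 1 - 2 * INR i) * v)) by ring.
    rewrite sin_neg. ring.
  - rewrite fsum_scal. unfold s. ring.
Qed.

Lemma dirichlet_sin k v : dirichlet k v * sin v = sin (INR k * v).
Proof.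
  pose proof (fsum_cos_sin k (INR k - 1) v) as H. unfold dirichlet.
  replace (INR k - 1 + 1 - 2 * INR k) with (- INR k) in H by ring.
  replace (INR k - 1 + 1) with (INR k) in H by ring.
  rewrite Ropp_mult_distr_l_reverse, sin_neg in H. lra.
Qed.

Lemma dirichlet_1 v : dirichlet 1 v = 1.
Proof.
  unfold dirichlet, fsum; simpl. rewrite Rplus_0_r.
  replace ((1 - 1 - 2 * 0) * v) with 0 by ring. apply cos_0.
Qed.

Lemma dirichlet_S k v :
  sin v <> 0 -> dirichlet (S k) v = cos v * dirichlet k v + cos (INR k * v).
Proof.
  intros Hs. apply (Rmult_eq_reg_r (sin v)); [|exact Hs].
  rewrite dirichlet_sin, Rmult_plus_distr_r, Rmult_assoc, dirichlet_sin, S_INR.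
  rewrite Rmult_plus_distr_r, Rmult_1_l, sin_plus. ring.
Qed.

(* For |C| >= 1/(k-1) the recursion [D' = C D + w] propagates the bound;
   for smaller |C| it follows from [|D' s| <= 1]. *)
Lemma dirichlet_step (k D D' C s w : R) :
  3 <= k -> Rabs D <= 1 + (k - 1) * C ^ 2 -> Rabs w <= 1 -> D' = C * D + w ->
  Rabs (D' * s) <= 1 -> s ^ 2 + C ^ 2 = 1 -> Rabs D' <= 1 + k * C ^ 2.
Proof.
  intros Hk HD Hw HD' Hs HsC.
  assert (HC1 : Rabs C <= 1) by (apply Rabs_le; nra).
  assert (HC2 : C ^ 2 = Rabs C ^ 2) by (rewrite RPow_abs, Rabs_pos_eq; nra).
  pose proof (Rabs_pos C) as HC0.
  destruct (Rle_lt_dec 1 (Rabs C * (k - 1))) as [H|H].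
  - rewrite HD'. eapply Rle_trans; [apply Rabs_triang|]. rewrite Rabs_mult, HC2 in *.
    set (c := Rabs C) in *.
    assert (c * Rabs D <= c * (1 + (k - 1) * c ^ 2)) by (apply Rmult_le_compat_l; lra).
    (* This product is exactly the slack [k c^2 - c - (k - 1) c^3] between [1 + c (1 + (k - 1) c^2)]
       and [1 + k c^2]. *)
    assert (0 <= c * ((1 - c) * (c * (k - 1) - 1))) by
      (apply Rmult_le_pos; [lra|apply Rmult_le_pos; lra]).
    nra.
  - assert (Hx : 0 <= C ^ 2 <= 1 / 4).
    { rewrite HC2. split; [nra|]. assert (Rabs C <= 1 / 2) by nra. nra. }
    set (x := C ^ 2) in *.
    assert (HDs : D' ^ 2 * (1 - x) <= 1).
    { replace (D' ^ 2 * (1 - x)) with (Rabs (D' * s) ^ 2).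
      - pose proof (Rabs_pos (D' * s)). nra.
      - rewrite RPow_abs, Rabs_pos_eq by nra. replace (1 - x) with (s ^ 2) by lra. ring. }
    (* By [HDs] this is enough. Expanding leaves [x] times a factor that [x <= 1/4] and [k >= 3]
       keep nonnegative. *)
    assert (Hb : 1 <= (1 + k * x) ^ 2 * (1 - x)).
    { assert (0 <= x * (2 * k - 1 + (k ^ 2 - 2 * k) * x - k ^ 2 * x ^ 2)); [|nra].
      apply Rmult_le_pos; [lra|].
      assert (k ^ 2 * x ^ 2 <= k ^ 2 * (x / 4)) by (apply Rmult_le_compat_l; nra).
      nra. }
    apply Rsqr_incr_0_var; [|nra]. rewrite <- Rsqr_abs. unfold Rsqr.
    apply (Rmult_le_reg_r (1 - x)); nra.
Qed.

Lemma Rabs_cos_le_1 x : Rabs (cos x) <= 1.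
Proof. apply Rabs_le. destruct (COS_bound x). lra. Qed.

Lemma Rabs_sin_le_1 x : Rabs (sin x) <= 1.
Proof. apply Rabs_le. destruct (SIN_bound x). lra. Qed.

(** The form is chosen to be linear in [k] and [k - 1]: summed over the layers of a law, these
    become its [mass] and its [overlap]. *)
Lemma dirichlet_bound k v :
  (1 <= k)%nat -> Rabs (dirichlet k v) <= INR k - (INR k - 1) * sin v ^ 2.
Proof.
  intros Hk. pose proof (sin2_cos2 v) as Hsc. unfold Rsqr in Hsc.
  destruct (Req_dec (sin v) 0) as [Hs|Hs].
  { rewrite Hs. eapply Rle_trans; [apply fsum_abs|].
    eapply Rle_trans; [apply (fsum_le _ _ (fun _ => 1 * 1))|].
    - intros; rewrite Rmult_1_l; apply Rabs_cos_le_1.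
    - rewrite fsum_const. simpl; lra. }
  replace (sin v ^ 2) with (1 - cos v ^ 2) by (simpl; lra).
  replace (INR k - (INR k - 1) * (1 - cos v ^ 2))
    with (1 + (INR k - 1) * cos v ^ 2) by ring.
  assert (HC : -1 <= cos v <= 1) by apply COS_bound.
  assert (H1 : dirichlet 1 v = 1) by apply dirichlet_1.
  assert (H2 : dirichlet 2 v = 2 * cos v).
  { rewrite dirichlet_S, H1 by exact Hs. simpl INR. rewrite Rmult_1_l. ring. }
  assert (H3 : dirichlet 3 v = 4 * cos v ^ 2 - 1).
  { rewrite dirichlet_S, H2 by exact Hs. simpl INR. replace (1 + 1) with 2 by ring.
    rewrite cos_2a_cos. ring. }
  (* [dirichlet_step] starts at [k = 3], so the first three kernels are treated by their closed
     forms. *)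
  destruct k as [|[|[|k]]]; [lia| | |].
  - rewrite H1, Rabs_R1. simpl; lra.
  - rewrite H2. apply Rabs_le. simpl; nra.
  - clear Hk. induction k as [|k IH].
    + rewrite H3. apply Rabs_le. simpl; nra.
    + rewrite (S_INR (S (S (S k)))).
      replace (INR (S (S (S k))) + 1 - 1) with (INR (S (S (S k)))) by ring.
      eapply dirichlet_step; [|exact IH| | | |].
      * rewrite !S_INR. pose proof (pos_INR k). lra.
      * apply Rabs_cos_le_1.
      * apply dirichlet_S, Hs.
      * rewrite dirichlet_sin. apply Rabs_sin_le_1.
      * simpl; lra.
Qed.

(** * Convolutions of uniform laws *)

(* [K] is symmetric unimodal about [d/2] (symmetry is a consequence of the integral
   formula), [phi] is its characteristic function centred there and read at [2 v]. *)
Definition kernel (K : Z -> R) (d : Z) (P : R -> R) : Prop :=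
  (forall z, (z < 0)%Z -> K z = 0) /\
  (forall x y, (x <= y)%Z -> (x + y <= d)%Z -> K x <= K y) /\
  (forall v, continuous P v) /\
  exists phi : R -> R,
    (forall v, continuous phi v) /\ (forall v, Rabs (phi v) <= P v) /\
    forall x, is_RInt (fun v => phi v * cos (IZR (d - 2 * x) * v)) 0 PI (PI * K x).

Definition on_nat (K : Z -> R) (m : nat) : R := K (Z.of_nat m).

Definition box (a k m : nat) : R := if (Nat.leb a m && Nat.ltb m (a + k))%bool then 1 else 0.

(** Convolution of [K] with an interval indicator, unnormalised; integer arguments avoid truncated
    subtraction. *)
Definition Zbox (K : Z -> R) (a k : nat) (x : Z) : R :=
  fsum k (fun j => K (x - Z.of_nat a - Z.of_nat j)%Z).

(** Truncated total variation of [h] extended by 0 to the left. For a law it tends to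
    [2 * dTV h (shift1 h)]; the truncation gives a finite sublinear functional, as
    [box_decomposition] requires. *)
Definition variation (M : nat) (h : nat -> R) : R :=
  fsum (S M) (fun m => Rabs (h m - shift1 h m)).

Lemma variation_S M h : variation (S M) h = variation M h + Rabs (h (S M) - h M).
Proof. unfold variation at 1. now rewrite fsum_S. Qed.

Lemma box_in a k m : (a <= m < a + k)%nat -> box a k m = 1.
Proof.
  intros H. unfold box. destruct (Nat.leb_spec a m), (Nat.ltb_spec m (a + k)); simpl; lia || reflexivity.
Qed.

Lemma box_out a k m : (m < a \/ a + k <= m)%nat -> box a k m = 0.
Proof.
  intros H. unfold box. destruct (Nat.leb_spec a m), (Nat.ltb_spec m (a + k)); simpl; lia || reflexivity.
Qed.

Lemma conv_box K a k m :
  (forall z, (z < 0)%Z -> K z = 0) ->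
  conv (box a k) (on_nat K) m = on_nat (Zbox K a k) m.
Proof.
  intros HK. pose (F := fun i => box a k i * K (Z.of_nat m - Z.of_nat i)%Z).
  transitivity (fsum (S m + (a + k)) F).
  - rewrite fsum_add, (fsum_0 (a + k)), Rplus_0_r.
    + apply fsum_ext; intros i Hi. unfold F, on_nat. do 2 f_equal. lia.
    + intros i Hi. unfold F. rewrite HK by lia. ring.
  - rewrite Nat.add_comm, !fsum_add, (fsum_0 a), (fsum_0 (S m)).
    + rewrite Rplus_0_l, Rplus_0_r. apply fsum_ext; intros i Hi. unfold F.
      rewrite box_in by lia. rewrite Rmult_1_l. f_equal. lia.
    + intros i Hi. unfold F. rewrite box_out by lia. ring.
    + intros i Hi. unfold F. rewrite box_out by lia. ring.
Qed.

(** The integral formula depends on [x] only through [|d - 2 x|], because cosine is even. *)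
Lemma kernel_sym K d P x : kernel K d P -> K (d - x)%Z = K x.
Proof.
  intros (_ & _ & _ & phi & _ & _ & H). apply (Rmult_eq_reg_l PI); [|apply PI_neq0].
  rewrite <- (is_RInt_unique _ _ _ _ (H x)), <- (is_RInt_unique _ _ _ _ (H (d - x)%Z)).
  apply RInt_ext; intros v _. f_equal.
  replace (d - 2 * (d - x))%Z with (- (d - 2 * x))%Z by lia.
  rewrite opp_IZR, Ropp_mult_distr_l_reverse. apply cos_neg.
Qed.

Lemma kernel_nonneg K d P x : kernel K d P -> 0 <= K x.
Proof.
  (* A point where [K] vanishes and which unimodality allows to be compared with [x]: [z < 0],
     [z <= x] and [z + x <= d]. *)
  intros (H0 & H1 & _). pose (z := Z.min (- 1) (Z.min x (d - x))).
  rewrite <- (H0 z) by lia. apply H1; lia.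
Qed.

Lemma is_RInt_continuous (P : R -> R) a b :
  (forall v, continuous P v) -> is_RInt P a b (RInt P a b).
Proof.
  intros HP. apply (RInt_correct (V := R_CompleteNormedModule)).
  apply (ex_RInt_continuous (V := R_CompleteNormedModule)). auto.
Qed.

Lemma kernel_le K d P x : kernel K d P -> K x <= / PI * RInt P 0 PI.
Proof.
  intros (_ & _ & HP & phi & _ & H2 & H). pose proof PI_RGT_0.
  apply (Rmult_le_reg_l PI); [lra|].
  rewrite <- Rmult_assoc, Rinv_r, Rmult_1_l by lra.
  apply (is_RInt_le (fun v => phi v * cos (IZR (d - 2 * x) * v)) P 0 PI); [lra|apply H| |].
  { now apply is_RInt_continuous. }
  intros v _. eapply Rle_trans; [apply Rle_abs|]. rewrite Rabs_mult.
  pose proof (Rabs_cos_le_1 (IZR (d - 2 * x) * v)). pose proof (Rabs_pos (phi v)).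
  specialize (H2 v). pose proof (Rabs_pos (cos (IZR (d - 2 * x) * v))). nra.
Qed.

(** A unimodal sequence climbs from 0 to its maximum and then descends, so its variation is at most
    twice the maximum, which [kernel_le] controls. *)
Lemma kernel_variation K d P M :
  kernel K d P -> variation M (on_nat K) <= 2 / PI * RInt P 0 PI.
Proof.
  intros HK. set (C := / PI * RInt P 0 PI).
  assert (HC : forall x, K x <= C) by (intros; eapply kernel_le; eassumption).
  replace (2 / PI * RInt P 0 PI) with (2 * C) by (unfold C, Rdiv; ring).
  (* Induction invariant: while climbing, the variation equals the current value; afterwards each
     descent is paid for by the term [- K M]. The step from [M - 1] to [M] climbs when
     [(M - 1) + M <= d]. *)
  enough (((2 * Z.of_nat M - 1 <= d)%Z -> variation M (on_nat K) = K (Z.of_nat M)) /\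
          variation M (on_nat K) <= 2 * C - K (Z.of_nat M)).
  { pose proof (kernel_nonneg _ _ _ (Z.of_nat M) HK). lra. }
  pose proof HK as (_ & Hmono & _).
  induction M as [|M [IH1 IH2]].
  - assert (E : variation 0 (on_nat K) = K 0%Z).
    { unfold variation, fsum, on_nat; simpl. rewrite Rminus_0_r, Rplus_0_r.
      apply Rabs_pos_eq, (kernel_nonneg _ _ _ _ HK). }
    split; [intros _; exact E|]. rewrite E. specialize (HC 0%Z). simpl; lra.
  - rewrite variation_S. change (on_nat K (S M)) with (K (Z.of_nat (S M))).
    change (on_nat K M) with (K (Z.of_nat M)).
    pose proof (HC (Z.of_nat (S M))).
    destruct (Z_le_gt_dec (2 * Z.of_nat (S M) - 1) d) as [Hd|Hd].
    + rewrite IH1 by lia.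
      assert (K (Z.of_nat M) <= K (Z.of_nat (S M))) by (apply Hmono; lia).
      rewrite Rabs_pos_eq by lra. split; [intros _|]; lra.
    + assert (K (Z.of_nat (S M)) <= K (Z.of_nat M)).
      { rewrite <- (kernel_sym _ _ _ (Z.of_nat (S M)) HK), <- (kernel_sym _ _ _ (Z.of_nat M) HK).
        apply Hmono; lia. }
      rewrite Rabs_left1 by lra. split; [lia|lra].
Qed.

Lemma is_RInt_fsum k (F : nat -> R -> R) (I : nat -> R) a b :
  (forall j, (j < k)%nat -> is_RInt (F j) a b (I j)) ->
  is_RInt (fun v => fsum k (fun j => F j v)) a b (fsum k I).
Proof.
  induction k as [|k IH]; intros H.
  - unfold fsum; simpl.
    pose proof (is_RInt_const (V := R_NormedModule) a b 0) as E. unfold scal in E; simpl in E.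
    unfold mult in E; simpl in E. rewrite Rmult_0_r in E. exact E.
  - rewrite fsum_S. apply (is_RInt_ext (fun v => plus (fsum k (fun j => F j v)) (F k v))).
    + intros; now rewrite fsum_S.
    + apply (is_RInt_plus (V := R_NormedModule)); auto with arith.
Qed.

Lemma continuous_fsum k (F : nat -> R -> R) v :
  (forall j, continuous (F j) v) -> continuous (fun v => fsum k (fun j => F j v)) v.
Proof.
  intros H. induction k as [|k IH].
  - apply continuous_const.
  - apply (continuous_ext (fun v => plus (fsum k (fun j => F j v)) (F k v))).
    + intros; now rewrite fsum_S.
    + now apply (continuous_plus (V := R_NormedModule)).
Qed.

Lemma continuous_cos_lin c v : continuous (fun v => cos (c * v)) v.
Proof.
  apply (ex_derive_continuous (K := R_AbsRing) (V := R_NormedModule)). auto_derive. trivial.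
Qed.

Lemma continuous_dirichlet k v : continuous (dirichlet k) v.
Proof. apply continuous_fsum; intros; apply continuous_cos_lin. Qed.

Lemma fsum_cos_shift k c v :
  fsum k (fun j => cos (c * v - (INR k - 1 - 2 * INR j) * v)) = dirichlet k v * cos (c * v).
Proof.
  transitivity (fsum k (fun j => cos (c * v) * cos ((INR k - 1 - 2 * INR j) * v) +
    sin (c * v) * sin ((INR k - 1 - 2 * INR j) * v))).
  - apply fsum_ext; intros; apply cos_minus.
  - rewrite fsum_plus, !fsum_scal, fsum_sin_antisym. unfold dirichlet. ring.
Qed.

Lemma Zbox_incr K a k x :
  Zbox K a k (x + 1) - Zbox K a k x =
  K (x + 1 - Z.of_nat a)%Z - K (x + 1 - Z.of_nat a - Z.of_nat k)%Z.
Proof.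
  unfold Zbox. induction k as [|k IH].
  - unfold fsum; simpl. rewrite Z.sub_0_r. ring.
  - rewrite !fsum_S.
    replace (x + 1 - Z.of_nat a - Z.of_nat (S k))%Z with (x - Z.of_nat a - Z.of_nat k)%Z by lia.
    lra.
Qed.

(** Adding a uniform variable keeps symmetric unimodality, multiplies the transform by [dirichlet k]
    and moves the centre; [dirichlet_bound] updates the majorant. *)
Lemma kernel_Zbox K d P a k :
  kernel K d P -> (1 <= k)%nat ->
  kernel (Zbox K a k) (d + 2 * Z.of_nat a + Z.of_nat k - 1)
    (fun v => P v * (INR k - (INR k - 1) * sin v ^ 2)).
Proof.
  intros (H0 & H1 & HP & phi & Hc & Hphi & H) Hk.
  set (d' := (d + 2 * Z.of_nat a + Z.of_nat k - 1)%Z).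
  assert (HR : forall x, is_RInt (fun v => phi v * dirichlet k v * cos (IZR (d' - 2 * x) * v))
      0 PI (PI * Zbox K a k x)).
  { intros x. unfold Zbox. rewrite <- fsum_scal.
    apply (is_RInt_ext (fun v => fsum k (fun j => phi v *
      cos (IZR (d - 2 * (x - Z.of_nat a - Z.of_nat j)) * v)))).
    - intros v _. rewrite fsum_scal, Rmult_assoc. f_equal.
      rewrite <- fsum_cos_shift. apply fsum_ext; intros j _. f_equal.
      rewrite <- Rmult_minus_distr_r. f_equal. unfold d'.
      rewrite !INR_IZR_INZ. rewrite <- !mult_IZR, <- !minus_IZR. f_equal. lia.
    - apply is_RInt_fsum; intros; apply H. }
  assert (Hsym : forall x, Zbox K a k (d' - x) = Zbox K a k x).
  { intros x. apply (Rmult_eq_reg_l PI); [|apply PI_neq0].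
    rewrite <- (is_RInt_unique _ _ _ _ (HR x)), <- (is_RInt_unique _ _ _ _ (HR (d' - x)%Z)).
    apply RInt_ext; intros v _. f_equal.
    replace (d' - 2 * (d' - x))%Z with (- (d' - 2 * x))%Z by lia.
    rewrite opp_IZR, Ropp_mult_distr_l_reverse. apply cos_neg. }
  (* One step compares [K] at two points [k] apart by [Zbox_incr]. Their sum is at most [d] exactly
     when the new point [y] has [2 y <= d' + 1]. *)
  assert (Hchain : forall n x, (2 * (x + Z.of_nat n) <= d' + 1)%Z ->
      Zbox K a k x <= Zbox K a k (x + Z.of_nat n)).
  { induction n as [|n IH]; intros x Hx; [rewrite Z.add_0_r; lra|].
    eapply Rle_trans; [apply IH; lia|].
    pose proof (Zbox_incr K a k (x + Z.of_nat n)) as E.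
    replace (x + Z.of_nat (S n))%Z with (x + Z.of_nat n + 1)%Z by lia.
    assert (K (x + Z.of_nat n + 1 - Z.of_nat a - Z.of_nat k)%Z <=
            K (x + Z.of_nat n + 1 - Z.of_nat a)%Z) by (apply H1; lia).
    lra. }
  repeat split.
  - intros z Hz. apply fsum_0; intros; apply H0; lia.
  - assert (Hc' : forall x y, (x <= y)%Z -> (2 * y <= d' + 1)%Z -> Zbox K a k x <= Zbox K a k y).
    { intros x y Hxy Hy. replace y with (x + Z.of_nat (Z.to_nat (y - x)))%Z by lia.
      apply Hchain. lia. }
    (* A point [y] beyond the centre is reflected to [d' - y], which is still at least [x]. *)
    intros x y Hxy Hd. destruct (Z_le_gt_dec (2 * y) (d' + 1)).
    + now apply Hc'.
    + rewrite <- (Hsym y). apply Hc'; lia.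
  - intros v. apply (continuous_mult (K := R_AbsRing)); [apply HP|].
    apply (ex_derive_continuous (K := R_AbsRing) (V := R_NormedModule)). auto_derive. trivial.
  - exists (fun v => phi v * dirichlet k v). split; [|split].
    + intros v. apply (continuous_mult (K := R_AbsRing)); [apply Hc|apply continuous_dirichlet].
    + intros v. rewrite Rabs_mult. apply Rmult_le_compat; try apply Rabs_pos.
      * apply Hphi.
      * now apply dirichlet_bound.
    + exact HR.
Qed.

(** Starting point of the box convolutions: a cosine of nonzero integer frequency integrates to 0
    over [[0, PI]]. *)
Lemma kernel_delta : kernel (fun z => if Z.eqb z 0 then 1 else 0) 0 (fun _ => 1).
Proof.
  repeat split.
  - intros z Hz. destruct (Z.eqb_spec z 0); [lia|reflexivity].
  - intros x y Hxy Hd. destruct (Z.eqb_spec x 0), (Z.eqb_spec y 0); try lra; lia.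
  - intros v; apply continuous_const.
  - exists (fun _ => 1). split; [intros; apply continuous_const|].
    split; [intros; rewrite Rabs_R1; lra|]. intros x.
    destruct (Z.eqb_spec x 0) as [->|Hx].
    + apply (is_RInt_ext (fun _ => 1)).
      * intros; simpl. rewrite Rmult_0_l, cos_0. ring.
      * replace (PI * 1) with (scal (PI - 0) 1) by (unfold scal; simpl; unfold mult; simpl; ring).
        apply (is_RInt_const (V := R_NormedModule)).
    + set (c := IZR (0 - 2 * x)).
      assert (Hc : c <> 0) by (apply not_0_IZR; lia).
      replace (PI * 0) with (minus (sin (c * PI) / c) (sin (c * 0) / c)).
      * apply (is_RInt_derive (V := R_CompleteNormedModule) (fun v => sin (c * v) / c)).
        -- intros v _. auto_derive; [trivial|]. field. exact Hc.
        -- intros v _. apply (continuous_ext (fun v => cos (c * v))); [intros; now rewrite Rmult_1_l|].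
           apply continuous_cos_lin.
      * rewrite Rmult_0_r, sin_0. unfold c.
        replace (sin (IZR (0 - 2 * x) * PI)) with 0.
        -- unfold minus, plus, opp; simpl. field. exact Hc.
        -- symmetry; apply sin_eq_0_1. exists (0 - 2 * x)%Z. reflexivity.
Qed.

(** * Decomposition into uniform laws *)

Lemma argmin (F : nat -> R) n :
  exists t, (t < S n)%nat /\ forall j, (j < S n)%nat -> F t <= F j.
Proof.
  induction n as [|n (t & Ht & H)].
  - exists 0%nat. split; [lia|]. intros j Hj. replace j with 0%nat by lia. lra.
  - destruct (Rle_dec (F t) (F (S n))) as [Hl|Hl].
    + exists t. split; [lia|]. intros j Hj.
      destruct (Nat.eq_dec j (S n)) as [->|]; [exact Hl|apply H; lia].
    + exists (S n). split; [lia|]. intros j Hj.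
      destruct (Nat.eq_dec j (S n)) as [->|]; [lra|].
      specialize (H j ltac:(lia)). lra.
Qed.

(* Layer-cake decomposition into interval indicators: subtract the minimum,
   which leaves a zero, and split the interval there. *)
Lemma box_decomposition (Phi : (nat -> R) -> R) (X Y : R) :
  (forall f g, (forall m, f m = g m) -> Phi f = Phi g) ->
  (forall f g, Phi (fun m => f m + g m) <= Phi f + Phi g) ->
  (forall c f, 0 <= c -> Phi (fun m => c * f m) <= c * Phi f) ->
  (forall a k, (1 <= k)%nat -> Phi (box a k) <= INR k * X - (INR k - 1) * Y) ->
  forall L a f, (forall m, (a <= m < a + L)%nat -> 0 <= f m) ->
  Phi (fun m => box a L m * f m) <=
    fsum L (fun j => f (a + j)%nat) * X
    - fsum (L - 1) (fun j => Rmin (f (a + j)%nat) (f (a + S j)%nat)) * Y.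
Proof.
  intros Hext Hadd Hscal Hbox L.
  induction L as [L IH] using lt_wf_ind. intros a f Hf.
  destruct L as [|L].
  { rewrite (Hext _ (fun m => 0 * box a 0 m)).
    - eapply Rle_trans; [apply Hscal, Rle_refl|]. unfold fsum; simpl. lra.
    - intros m. rewrite box_out by lia. ring. }
  destruct (argmin (fun j => f (a + j)%nat) L) as (t & Ht & Hmin).
  set (c := f (a + t)%nat) in *. cbv beta in Hmin.
  set (f' := fun m => f m - c).
  assert (Hf' : forall m, (a <= m < a + S L)%nat -> 0 <= f' m).
  { intros m Hm. unfold f'. specialize (Hmin (m - a)%nat ltac:(lia)).
    replace (a + (m - a))%nat with m in Hmin by lia. lra. }
  set (r := (L - t)%nat).
  pose proof (IH t Ht a f' ltac:(intros; apply Hf'; lia)) as IHl.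
  pose proof (IH r ltac:(lia) (a + S t)%nat f' ltac:(intros; apply Hf'; lia)) as IHr.
  pose proof (Hbox a (S L) ltac:(lia)) as HB.
  assert (Hc : 0 <= c) by (apply Hf; lia).
  set (e := fun j => Rmin (f' (a + j)%nat) (f' (a + S j)%nat)) in *.
  (* One of the two arguments of the minimum is the zero at [a + t], so cutting the interval there
     loses no overlap. *)
  assert (He0 : forall j, (j < L)%nat -> (j = t \/ S j = t) -> e j = 0).
  { intros j Hj Hjt. unfold e.
    assert (f' (a + t)%nat = 0) by (unfold f', c; ring).
    destruct Hjt as [->|<-].
    - rewrite Rmin_left; [assumption|]. rewrite H. apply Hf'; lia.
    - rewrite Rmin_right; [assumption|]. rewrite H. apply Hf'; lia. }
  assert (Hsum : fsum (S L) (fun j => f (a + j)%nat) =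
    fsum t (fun j => f' (a + j)%nat) + fsum r (fun j => f' (a + S t + j)%nat) + INR (S L) * c).
  { rewrite <- (fsum_const (S L) c).
    replace (S L) with (t + S r)%nat by lia. rewrite !fsum_add, !fsum_Sl.
    unfold f'. rewrite !fsum_minus. fold c.
    replace (f (a + (t + 0))%nat) with c by (unfold c; f_equal; lia).
    rewrite (fsum_ext r (fun j => f (a + (t + S j))%nat) (fun j => f (a + S t + j)%nat))
      by (intros; f_equal; lia).
    ring. }
  assert (Hmins : fsum (S L - 1) (fun j => Rmin (f (a + j)%nat) (f (a + S j)%nat)) =
    fsum (t - 1) e + fsum (r - 1) (fun j => Rmin (f' (a + S t + j)%nat) (f' (a + S t + S j)%nat))
    + INR L * c).
  { rewrite <- (fsum_const L c).
    rewrite (fsum_ext (S L - 1) _ (fun j => e j + c)).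
    2:{ intros j _. unfold e, f'. unfold Rmin.
        destruct (Rle_dec (f (a + j)%nat) (f (a + S j)%nat)),
          (Rle_dec (f (a + j)%nat - c) (f (a + S j)%nat - c)); lra. }
    replace (S L - 1)%nat with L by lia. rewrite fsum_plus. f_equal.
    replace L with (t + r)%nat at 1 by lia. rewrite fsum_add. f_equal.
    - destruct t as [|t]; [reflexivity|]. replace (S t - 1)%nat with t by lia.
      rewrite fsum_S, He0 by lia. ring.
    - destruct r as [|r0] eqn:Er; [reflexivity|]. replace (S r0 - 1)%nat with r0 by lia.
      rewrite fsum_Sl, He0 by lia. rewrite Rplus_0_l. apply fsum_ext; intros j _.
      unfold e. f_equal; f_equal; lia. }
  rewrite Hsum, Hmins.
  rewrite (Hext _ (fun m => c * box a (S L) m +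
    (box a t m * f' m + box (a + S t) r m * f' m))).
  2:{ intros m. unfold f'. destruct (Nat.lt_ge_cases m a); [rewrite !box_out by lia; ring|].
      destruct (Nat.lt_ge_cases m (a + t));
        [rewrite (box_in a t), (box_in a (S L)), box_out by lia; ring|].
      destruct (Nat.eq_dec m (a + t)) as [->|];
        [rewrite (box_in a (S L)), !box_out by lia; fold c; ring|].
      destruct (Nat.lt_ge_cases m (a + S L));
        [rewrite (box_in (a + S t)), (box_in a (S L)), box_out by lia; ring|].
      rewrite !box_out by lia; ring. }
  eapply Rle_trans; [apply Hadd|].
  pose proof (Hadd (fun m => box a t m * f' m) (fun m => box (a + S t) r m * f' m)) as H2.
  pose proof (Hscal c (box a (S L)) Hc) as H1.
  apply (Rmult_le_compat_l c) in HB; [|exact Hc].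
  rewrite S_INR in HB |- *. lra.
Qed.

Fixpoint fprod (n : nat) (F : nat -> R) : R :=
  match n with O => 1 | S k => fprod k F * F k end.

Lemma continuous_fprod n (F : nat -> R -> R) v :
  (forall j, continuous (F j) v) -> continuous (fun v => fprod n (fun j => F j v)) v.
Proof.
  intros H. induction n as [|n IH].
  - apply continuous_const.
  - apply (continuous_mult (K := R_AbsRing)); auto.
Qed.

Lemma fprod_bounds n F G :
  (forall i, (i < n)%nat -> 0 <= F i <= G i) -> 0 <= fprod n F <= fprod n G.
Proof.
  induction n as [|n IH]; intros H; simpl; [lra|].
  specialize (IH ltac:(auto with arith)). specialize (H n ltac:(lia)).
  split; [apply Rmult_le_pos; lra|]. apply Rmult_le_compat; lra.
Qed.

Lemma fprod_exp n F : fprod n (fun i => exp (F i)) = exp (fsum n F).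
Proof.
  induction n as [|n IH]; simpl; [symmetry; apply exp_0|]. now rewrite IH, fsum_S, exp_plus.
Qed.

Definition mass (f : nat -> R) (M : nat) : R := fsum (S M) f.
(** Since [min(x, y) = (x + y - |x - y|) / 2], this is a truncation of [1 - dTV f (shift1 f)] for a
    law [f]. *)
Definition overlap (f : nat -> R) (M : nat) : R := fsum M (fun j => Rmin (f j) (f (S j))).

Lemma variation_ext M f g :
  (forall m, (m <= M)%nat -> f m = g m) -> variation M f = variation M g.
Proof.
  intros H. apply fsum_ext; intros m Hm. rewrite H by lia.
  destruct m; [reflexivity|]. simpl. now rewrite H by lia.
Qed.

Lemma variation_plus M f g :
  variation M (fun m => f m + g m) <= variation M f + variation M g.
Proof.
  unfold variation. rewrite <- fsum_plus. apply fsum_le; intros [|m] _; simpl;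
    (eapply Rle_trans; [|apply Rabs_triang]; right; f_equal; ring).
Qed.

Lemma variation_scal M c f : 0 <= c -> variation M (fun m => c * f m) = c * variation M f.
Proof.
  intros Hc.
  assert (H : forall x y, Rabs (c * x - c * y) = c * Rabs (x - y)).
  { intros. rewrite <- Rmult_minus_distr_l, Rabs_mult. now rewrite (Rabs_pos_eq c). }
  unfold variation. rewrite <- fsum_scal. apply fsum_ext; intros [|m] _; simpl.
  - rewrite <- H. f_equal; ring.
  - apply H.
Qed.

Lemma continuous_sin2 v : continuous (fun v => sin v ^ 2) v.
Proof.
  apply (ex_derive_continuous (K := R_AbsRing) (V := R_NormedModule)). auto_derive. trivial.
Qed.

Lemma continuous_lin_sin2 a b v : continuous (fun v => a - b * sin v ^ 2) v.
Proof.
  apply (ex_derive_continuous (K := R_AbsRing) (V := R_NormedModule)). auto_derive. trivial.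
Qed.

Lemma RInt_ext_R (f g : R -> R) a b : (forall v, f v = g v) -> RInt f a b = RInt g a b.
Proof. intros H. apply RInt_ext; intros; apply H. Qed.

Lemma RInt_lin (F : R -> R) (x y a b : R) :
  (forall v, continuous F v) ->
  RInt (fun v => F v * (x - y * sin v ^ 2)) a b =
  x * RInt F a b - y * RInt (fun v => F v * sin v ^ 2) a b.
Proof.
  intros HF. apply is_RInt_unique.
  apply (is_RInt_ext (fun v => minus (scal x (F v)) (scal y (F v * sin v ^ 2)))).
  { intros v _. unfold minus, plus, opp, scal; simpl. unfold mult; simpl. ring. }
  apply (is_RInt_minus (V := R_NormedModule)); apply (is_RInt_scal (V := R_NormedModule)).
  - now apply is_RInt_continuous.
  - apply is_RInt_continuous. intros v. apply (continuous_mult (K := R_AbsRing));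
      [apply HF|apply continuous_sin2].
Qed.

(** Majorant of the characteristic function after mixing over the layers of each summand: a
    [k]-point layer adds [k] to the mass and [k - 1] to the overlap. *)
Definition profile (f : nat -> nat -> R) (n M : nat) (v : R) : R :=
  fprod n (fun i => mass (f i) M - overlap (f i) M * sin v ^ 2).

Lemma continuous_profile f n M v : continuous (profile f n M) v.
Proof. apply continuous_fprod; intros; apply continuous_lin_sin2. Qed.

(** The laws are peeled off one at a time: each is split into intervals, and each interval is
    absorbed into the kernel. Hence the induction runs over all kernels [K] at once. *)
Lemma variation_conv_kernel (f : nat -> nat -> R) M n :
  (forall i m, (i < n)%nat -> 0 <= f i m) ->
  forall K d P, kernel K d P ->
  variation M (conv (law_sum f n) (on_nat K)) <=
    2 / PI * RInt (fun v => P v * profile f n M v) 0 PI.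
Proof.
  induction n as [|n IH]; intros Hf K d P HK.
  - rewrite (variation_ext M _ (on_nat K)).
    + rewrite (RInt_ext_R _ P); [eapply kernel_variation, HK|].
      intros v. unfold profile; simpl. apply Rmult_1_r.
    + intros m _. simpl law_sum. rewrite conv_comm. apply conv_delta0_r.
  - specialize (IH ltac:(auto with arith)).
    set (Phi := fun g => variation M (conv (law_sum f n) (conv g (on_nat K)))).
    set (F := fun v => P v * profile f n M v).
    assert (HF : forall v, continuous F v).
    { intros v. apply (continuous_mult (K := R_AbsRing)); [apply HK|apply continuous_profile]. }
    set (X := 2 / PI * RInt F 0 PI).
    set (Y := 2 / PI * RInt (fun v => F v * sin v ^ 2) 0 PI).
    assert (HD := box_decomposition Phi X Y).
    assert (Hext : forall f g, (forall m, (m <= M)%nat -> f m = g m) -> Phi f = Phi g).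
    { intros g g' Hg. apply variation_ext; intros m Hm.
      apply conv_ext; [reflexivity|]. intros k Hk. apply conv_ext; [|reflexivity].
      intros j Hj. apply Hg. lia. }
    specialize (HD ltac:(intros; apply Hext; auto)).
    specialize (HD ltac:(intros g g'; unfold Phi; rewrite <- variation_plus;
      right; apply variation_ext; intros m _; rewrite <- conv_plus_r;
      apply conv_ext; [reflexivity|intros; apply conv_plus_l])).
    specialize (HD ltac:(intros c g Hc; unfold Phi; rewrite <- variation_scal by exact Hc;
      right; apply variation_ext; intros m _; rewrite <- conv_scal_r;
      apply conv_ext; [reflexivity|intros; apply conv_scal_l])).
    assert (Hbox : forall a k, (1 <= k)%nat -> Phi (box a k) <= INR k * X - (INR k - 1) * Y).
    { intros a k Hk. unfold Phi.
      rewrite (variation_ext M _ (conv (law_sum f n) (on_nat (Zbox K a k)))).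
      2:{ intros m _. apply conv_ext; [reflexivity|]. intros; apply conv_box, HK. }
      eapply Rle_trans; [apply (IH _ _ _ (kernel_Zbox _ _ _ a k HK Hk))|].
      rewrite (RInt_ext_R _ (fun v => F v * (INR k - (INR k - 1) * sin v ^ 2))).
      - rewrite RInt_lin by exact HF. unfold X, Y. right; ring.
      - intros v. unfold F. ring. }
    specialize (HD Hbox (S M) 0%nat (f n) ltac:(intros; apply Hf; lia)).
    replace (S M - 1)%nat with M in HD by lia.
    (* [Phi] sees only values up to [M], so cutting [f n] off at [M] changes nothing. *)
    rewrite (Hext _ (f n)) in HD by (intros m Hm; rewrite box_in by lia; ring).
    rewrite (variation_ext M _ (conv (law_sum f n) (conv (f n) (on_nat K))))
      by (intros; simpl law_sum; apply conv_assoc).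
    change (Phi (f n) <= 2 / PI * RInt (fun v => P v * profile f (S n) M v) 0 PI).
    change (Phi (f n) <= mass (f n) M * X - overlap (f n) M * Y) in HD.
    eapply Rle_trans; [exact HD|].
    rewrite (RInt_ext_R (fun v => P v * profile f (S n) M v)
      (fun v => F v * (mass (f n) M - overlap (f n) M * sin v ^ 2))).
    + rewrite RInt_lin by exact HF. unfold X, Y. right; ring.
    + intros v. unfold F, profile; simpl. ring.
Qed.

(** * The arcsine integral *)

(** A partial sum of the Leibniz series, precise enough for the polynomial inequality in
    [integral_exp_sin2]. *)
Lemma PI_upper_bound : PI <= 326 / 100.
Proof.
  pose proof (proj2 (PI_ineq 4)) as H. unfold tg_alt, PI_tg in H.
  cbn -[INR Rinv] in H. simpl INR in H. lra.
Qed.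

(* The antiderivative of 1/(1 + b sin^2), continuous across PI/2:
   [atan (c tan v) - v = atan ((c - 1) sin v cos v / (cos^2 v + c sin^2 v))]. *)
Definition atan_primitive (c v : R) : R :=
  v + atan ((c - 1) * (sin v * cos v) / (cos v ^ 2 + c * sin v ^ 2)).

Lemma is_derive_atan_primitive c v :
  1 <= c -> is_derive (atan_primitive c) v (c / (1 + (c ^ 2 - 1) * sin v ^ 2)).
Proof.
  intros Hc. pose proof (sin2_cos2 v) as H. unfold Rsqr in H.
  assert (HC : cos v ^ 2 = 1 - sin v ^ 2) by (simpl; lra).
  assert (Hs : 0 <= sin v ^ 2) by (apply pow2_ge_0).
  assert (HN : cos v ^ 2 + c * sin v ^ 2 <> 0) by (rewrite HC; nra).
  unfold atan_primitive. auto_derive; [simpl in HN |- *; lra|].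
  assert (HD : 1 + (c ^ 2 - 1) * sin v ^ 2 <> 0) by nra.
  assert (HE : (cos v ^ 2 + c * sin v ^ 2) ^ 2 + ((c - 1) * (sin v * cos v)) ^ 2 <> 0).
  { assert (0 < (cos v ^ 2 + c * sin v ^ 2) ^ 2) by (apply pow2_gt_0, HN).
    pose proof (pow2_ge_0 ((c - 1) * (sin v * cos v))). lra. }
  unfold Rsqr. field [HC].
  repeat split; auto; intros E; [apply HN|apply HE]; rewrite <- E; ring.
Qed.

(** Reduction formula: the derivatives of [E2] and [E] lower the power of [1 / (1 + b sin^2)] from 3
    to 2 and from 2 to 1, and the first power integrates to the arctangent. *)
Lemma RInt_inv_cube b :
  0 <= b ->
  is_RInt (fun v => / (1 + b * sin v ^ 2) ^ 3) 0 PI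
    (PI * (3 * b ^ 2 + 8 * b + 8) / (8 * sqrt (1 + b) ^ 5)).
Proof.
  intros Hb. set (c := sqrt (1 + b)).
  assert (Hc2 : c ^ 2 = 1 + b) by (apply pow2_sqrt; lra).
  assert (Hc : 1 <= c) by (unfold c; rewrite <- sqrt_1 at 1; apply sqrt_le_1_alt; lra).
  assert (HD : forall v, 1 + b * sin v ^ 2 > 0).
  { intros v. pose proof (Rmult_le_pos _ _ Hb (pow2_ge_0 (sin v))). lra. }
  set (E := fun v => sin v * cos v / (1 + b * sin v ^ 2)).
  set (E2 := fun v => sin v * cos v / (1 + b * sin v ^ 2) ^ 2).
  set (F := fun v => / (4 * (b + 1)) *
    (b * E2 v + 3 * (b + 2) / (2 * (b + 1)) * (b * E v) +
     (3 * (b + 2) ^ 2 / (2 * (b + 1)) - 2) / c * atan_primitive c v)).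
  assert (HF : forall v, is_derive F v (/ (1 + b * sin v ^ 2) ^ 3)).
  { intros v. pose proof (sin2_cos2 v) as H. unfold Rsqr in H.
    assert (HC : cos v ^ 2 = 1 - sin v ^ 2) by (simpl; lra).
    specialize (HD v).
    assert (HE : is_derive E v ((1 - 2 * sin v ^ 2) / (1 + b * sin v ^ 2)
       - 2 * b * sin v ^ 2 * (1 - sin v ^ 2) / (1 + b * sin v ^ 2) ^ 2)).
    { unfold E. auto_derive; [simpl in HD; simpl; lra|]. field [HC]. lra. }
    assert (HE2 : is_derive E2 v ((1 - 2 * sin v ^ 2) / (1 + b * sin v ^ 2) ^ 2
       - 4 * b * sin v ^ 2 * (1 - sin v ^ 2) / (1 + b * sin v ^ 2) ^ 3)).
    { unfold E2. auto_derive; [apply Rmult_integral_contrapositive; simpl in HD; simpl; split; nra|].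
      field [HC]. lra. }
    pose proof (is_derive_atan_primitive c v Hc) as HA.
    rewrite Hc2 in HA. replace (1 + b - 1) with b in HA by ring.
    unfold F.
    evar_last.
    { apply is_derive_scal. apply (is_derive_plus (V := R_NormedModule)); [apply (is_derive_plus (V := R_NormedModule))|].
      - apply is_derive_scal, HE2.
      - apply is_derive_scal, is_derive_scal, HE.
      - apply is_derive_scal, HA. }
    unfold plus; simpl. field. simpl in HD. repeat split; lra. }
  assert (HI := is_RInt_derive (V := R_CompleteNormedModule) F
    (fun v => / (1 + b * sin v ^ 2) ^ 3) 0 PI (fun v _ => HF v)).
  assert (HFF : F PI - F 0 = PI * (3 * b ^ 2 + 8 * b + 8) / (8 * c ^ 5)); [|rewrite <- HFF].
  (* [sin] vanishes at both ends, so only the linear part of [atan_primitive] contributes, with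
     total increment [PI]. *)
  - unfold F, E, E2, atan_primitive. rewrite sin_PI, cos_PI, sin_0, cos_0.
    replace ((c - 1) * (0 * -1) / ((-1) ^ 2 + c * 0 ^ 2)) with 0 by (unfold Rdiv; ring).
    replace ((c - 1) * (0 * 1) / (1 ^ 2 + c * 0 ^ 2)) with 0 by (unfold Rdiv; ring).
    rewrite atan_0. replace (c ^ 5) with (c * (1 + b) ^ 2) by (rewrite <- Hc2; ring).
    field. split; lra.
  - apply HI. intros v _.
    apply (ex_derive_continuous (K := R_AbsRing) (V := R_NormedModule)). specialize (HD v).
    auto_derive. simpl in HD. simpl. repeat (apply Rmult_integral_contrapositive; split); lra.
Qed.

Lemma integral_exp_sin2 s :
  0 <= s ->
  2 / PI * RInt (fun v => exp (- s * sin v ^ 2)) 0 PI <= 2 * (sqrt (2 / PI) * / sqrt (/ 4 + s)).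
Proof.
  intros Hs. pose proof PI_RGT_0 as HPI. pose proof PI_upper_bound as HPI'.
  set (b := s / 3). assert (Hb : 0 <= b) by (unfold b; lra).
  assert (H1 : RInt (fun v => exp (- s * sin v ^ 2)) 0 PI <=
    PI * (3 * b ^ 2 + 8 * b + 8) / (8 * sqrt (1 + b) ^ 5)).
  { apply (is_RInt_le (fun v => exp (- s * sin v ^ 2)) (fun v => / (1 + b * sin v ^ 2) ^ 3) 0 PI).
    - lra.
    - apply is_RInt_continuous. intros v.
      apply (ex_derive_continuous (K := R_AbsRing) (V := R_NormedModule)). auto_derive. trivial.
    - now apply RInt_inv_cube.
    (* With [b = s / 3] the exponential is a cube, and each factor is bounded by
       [1 + y <= exp y]. *)
    - intros v _. pose proof (pow2_ge_0 (sin v)) as Hv.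
      assert (0 <= b * sin v ^ 2) by nra.
      replace (- s * sin v ^ 2) with (- (b * sin v ^ 2 + b * sin v ^ 2 + b * sin v ^ 2))
        by (unfold b; field).
      rewrite exp_Ropp, !exp_plus. apply Rinv_le_contravar; [apply pow_lt; lra|].
      pose proof (exp_ineq1_le (b * sin v ^ 2)).
      replace (exp (b * sin v ^ 2) * exp (b * sin v ^ 2) * exp (b * sin v ^ 2))
        with (exp (b * sin v ^ 2) ^ 3) by ring.
      apply pow_incr; lra. }
  apply (Rmult_le_compat_l (2 / PI)) in H1; [|apply Rlt_le, Rdiv_lt_0_compat; lra].
  eapply Rle_trans; [exact H1|].
  set (c := sqrt (1 + b)).
  assert (Hc2 : c ^ 2 = 1 + b) by (apply pow2_sqrt; lra).
  assert (Hc : 0 < c) by (apply sqrt_lt_R0; lra).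
  replace (2 / PI * (PI * (3 * b ^ 2 + 8 * b + 8) / (8 * c ^ 5)))
    with (2 * ((1 + b + 3 * b ^ 2 / 8) / c ^ 5)) by (field; lra).
  apply Rmult_le_compat_l; [lra|].
  change (sqrt (2 / PI) * / sqrt (/ 4 + s)) with (sqrt (2 / PI) / sqrt (/ 4 + s)).
  rewrite <- sqrt_div by (try apply Rlt_le, Rdiv_lt_0_compat; lra).
  (* Both sides become square roots; comparing the radicands and using [c^2 = 1 + b] leaves a
     polynomial inequality in [b]. *)
  rewrite <- (sqrt_pow2 ((1 + b + 3 * b ^ 2 / 8) / c ^ 5)).
  2:{ apply Rlt_le, Rdiv_lt_0_compat; [nra|now apply pow_lt]. }
  apply sqrt_le_1_alt.
  replace (((1 + b + 3 * b ^ 2 / 8) / c ^ 5) ^ 2)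
    with ((1 + b + 3 * b ^ 2 / 8) ^ 2 / (1 + b) ^ 5) by (rewrite <- Hc2; field; lra).
  replace (2 / PI / (/ 4 + s)) with (2 / (PI * (/ 4 + 3 * b))) by (unfold b; field; lra).
  assert (Hpos : 0 < (1 + b) ^ 5) by (apply pow_lt; lra).
  assert (Hpos2 : 0 < PI * (/ 4 + 3 * b)) by (apply Rmult_lt_0_compat; lra).
  apply (Rmult_le_reg_r ((1 + b) ^ 5)); [exact Hpos|].
  apply (Rmult_le_reg_r (PI * (/ 4 + 3 * b))); [exact Hpos2|].
  replace ((1 + b + 3 * b ^ 2 / 8) ^ 2 / (1 + b) ^ 5 * (1 + b) ^ 5 * (PI * (/ 4 + 3 * b)))
    with (PI * ((1 + b + 3 * b ^ 2 / 8) ^ 2 * (/ 4 + 3 * b))) by (field; lra).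
  replace (2 / (PI * (/ 4 + 3 * b)) * (1 + b) ^ 5 * (PI * (/ 4 + 3 * b)))
    with (2 * (1 + b) ^ 5) by (field; lra).
  apply Rle_trans with (326 / 100 * ((1 + b + 3 * b ^ 2 / 8) ^ 2 * (/ 4 + 3 * b))).
  - apply Rmult_le_compat_r; [|lra]. apply Rmult_le_pos; [apply pow2_ge_0|lra].
  (* A quintic inequality on [b >= 0]; squares of [b - 1/2] are supplied because the two sides are
     relatively closest for [b] of that size. *)
  - clear - Hb. assert (0 <= b ^ 2) by apply pow2_ge_0.
    pose proof (pow2_ge_0 (b - 1 / 2)). assert (0 <= b * b ^ 2) by nra.
    pose proof (pow2_ge_0 (b ^ 2)). assert (0 <= b * b ^ 4) by nra.
    assert (0 <= b * (b - 1/2) ^ 2) by nra.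
    nra.
Qed.

(** * Smoothness of a sum of independent variables *)

Lemma conv_sum_f_R0 f g m : conv f g m = sum_f_R0 (fun k => f k * g (m - k)%nat) m.
Proof. rewrite <- sum_n_Reals, sum_n_fsum. reflexivity. Qed.

Lemma law_sum_nonneg f n m :
  (forall i m, (i < n)%nat -> 0 <= f i m) -> 0 <= law_sum f n m.
Proof.
  revert m; induction n as [|n IH]; intros m H; simpl.
  - unfold delta0. destruct (Nat.eqb m 0); lra.
  - apply conv_nonneg; auto.
Qed.

Lemma is_series_delta0 : is_series delta0 1.
Proof.
  apply is_series_fsum, is_lim_seq_incr_1.
  apply (is_lim_seq_ext (fun _ => 1)); [|apply is_lim_seq_const].
  intros n. rewrite fsum_Sl, fsum_0; [unfold delta0; simpl; ring|]. reflexivity.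
Qed.

Lemma is_series_law_sum f n :
  (forall i m, (i < n)%nat -> 0 <= f i m) -> (forall i, (i < n)%nat -> is_series (f i) 1) ->
  is_series (law_sum f n) 1.
Proof.
  induction n as [|n IH]; intros H0 H1; [apply is_series_delta0|].
  replace 1 with (1 * 1) by ring. simpl.
  apply (is_series_ext _ _ _ (fun m => eq_sym (conv_sum_f_R0 (law_sum f n) (f n) m))).
  apply is_series_mult_pos; auto. intros; apply law_sum_nonneg; auto.
Qed.

Lemma fsum_shift1 f n : fsum (S n) (shift1 f) = fsum n f.
Proof. rewrite fsum_Sl. simpl. apply Rplus_0_l. Qed.

Lemma is_series_shift1 f l : is_series f l -> is_series (shift1 f) l.
Proof.
  rewrite !is_series_fsum. intros H. apply is_lim_seq_incr_1.
  apply (is_lim_seq_ext (fun n => fsum n f)); [|exact H].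
  intros; now rewrite fsum_shift1.
Qed.

Lemma ex_series_dist f g :
  (forall m, 0 <= f m) -> (forall m, 0 <= g m) -> ex_series f -> ex_series g ->
  ex_series (fun m => Rabs (f m - g m)).
Proof.
  intros Hf Hg Ef Eg.
  apply (ex_series_le (K := R_AbsRing) (V := R_CompleteNormedModule) _ (fun m => f m + g m)).
  - intros m. unfold norm; simpl. unfold abs; simpl. rewrite Rabs_Rabsolu.
    specialize (Hf m). specialize (Hg m). apply Rabs_le. lra.
  - now apply (ex_series_plus (K := R_AbsRing) (V := R_NormedModule)).
Qed.

Lemma shift1_nonneg f m : (forall m, 0 <= f m) -> 0 <= shift1 f m.
Proof. intros H. destruct m; [apply Rle_refl|apply H]. Qed.

Lemma variation_lim f :
  (forall m, 0 <= f m) -> is_series f 1 ->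
  is_lim_seq (fun M => variation M f) (2 * dTV f (shift1 f)).
Proof.
  intros H0 H1. unfold dTV. rewrite <- Rmult_assoc, Rinv_r, Rmult_1_l by lra.
  apply (is_lim_seq_incr_1 (fun n => fsum n (fun m => Rabs (f m - shift1 f m)))).
  apply is_series_fsum, Series_correct, ex_series_dist.
  - exact H0.
  - intros; now apply shift1_nonneg.
  - now exists 1.
  - exists 1; now apply is_series_shift1.
Qed.

(** Sum of [|x - y| = x + y - 2 min(x, y)]. The shifted sequence starts with 0, so its partial sum
    has one term fewer. *)
Lemma variation_overlap f M :
  0 <= f 0%nat -> variation M f = fsum (S M) f + fsum M f - 2 * overlap f M.
Proof.
  intros H0. unfold overlap. induction M as [|M IH].
  - unfold variation, fsum; simpl. rewrite Rminus_0_r, Rabs_pos_eq; lra.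
  - rewrite variation_S, IH, (fsum_S (S M)), (fsum_S M f), (fsum_S M (fun j => Rmin _ _)).
    unfold Rmin, Rabs. destruct (Rle_dec (f M) (f (S M))), (Rcase_abs (f (S M) - f M)); lra.
Qed.

Lemma overlap_lim f :
  (forall m, 0 <= f m) -> is_series f 1 ->
  is_lim_seq (overlap f) (1 - dTV f (shift1 f)).
Proof.
  intros H0 H1. pose proof (variation_lim f H0 H1) as HV. apply is_series_fsum in H1.
  apply (is_lim_seq_ext (fun M => / 2 * (fsum (S M) f + fsum M f - variation M f))).
  - intros M. rewrite variation_overlap by apply H0. field.
  - replace (Finite (1 - dTV f (shift1 f)))
      with (Rbar_mult (/ 2) (1 + 1 - 2 * dTV f (shift1 f))) by (simpl; f_equal; field).
    apply is_lim_seq_scal_l. apply is_lim_seq_minus'; [apply is_lim_seq_plus'|exact HV].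
    + now apply is_lim_seq_incr_1 in H1.
    + exact H1.
Qed.

Lemma is_lim_seq_fsum n (F : nat -> nat -> R) (l : nat -> R) :
  (forall i, (i < n)%nat -> is_lim_seq (F i) (l i)) ->
  is_lim_seq (fun M => fsum n (fun i => F i M)) (fsum n l).
Proof.
  induction n as [|n IH]; intros H; [apply is_lim_seq_const|].
  rewrite fsum_S.
  apply (is_lim_seq_ext (fun M => fsum n (fun i => F i M) + F n M)).
  - intros; now rewrite fsum_S.
  - apply is_lim_seq_plus'; auto with arith.
Qed.

Lemma fsum_le_series f n l :
  (forall m, 0 <= f m) -> is_series f l -> 0 <= fsum n f <= l.
Proof.
  intros H0 H1. split; [now apply fsum_nonneg|]. apply is_series_fsum in H1.
  apply (is_lim_seq_incr_compare _ _ H1).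
  intros; rewrite fsum_S. specialize (H0 n0). lra.
Qed.

Lemma overlap_bounds f M : (forall m, 0 <= f m) -> 0 <= overlap f M <= mass f M.
Proof.
  intros H0. unfold overlap, mass. split.
  - apply fsum_nonneg; intros. now apply Rmin_glb.
  - rewrite fsum_S. apply Rle_trans with (fsum M f).
    + apply fsum_le; intros; apply Rmin_l.
    + specialize (H0 M). lra.
Qed.

(** [variation_conv_kernel] is applied with the point mass at 0 as kernel, and the resulting product
    is replaced by an exponential. *)
Lemma variation_law_sum f n M :
  (forall i m, (i < n)%nat -> 0 <= f i m) -> (forall i, (i < n)%nat -> is_series (f i) 1) ->
  variation M (law_sum f n) <=
    2 * (sqrt (2 / PI) * / sqrt (/ 4 + fsum n (fun i => overlap (f i) M))).
Proof.
  intros H0 H1. set (s := fsum n (fun i => overlap (f i) M)).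
  assert (Hs : 0 <= s) by (apply fsum_nonneg; intros; apply overlap_bounds; auto).
  eapply Rle_trans; [|apply integral_exp_sin2, Hs].
  rewrite (variation_ext M _ (conv (law_sum f n)
    (on_nat (fun z => if Z.eqb z 0 then 1 else 0)))).
  2:{ intros m _. rewrite <- (conv_delta0_r (law_sum f n) m) at 1.
      apply conv_ext; [reflexivity|]. intros k _. unfold delta0, on_nat.
      destruct k; reflexivity. }
  eapply Rle_trans; [apply (variation_conv_kernel f M n H0 _ _ _ kernel_delta)|].
  pose proof PI_RGT_0.
  apply Rmult_le_compat_l; [apply Rlt_le, Rdiv_lt_0_compat; lra|].
  apply RInt_le; [lra| | |].
  - eexists. apply is_RInt_continuous. intros v. apply (continuous_mult (K := R_AbsRing));
      [apply continuous_const|apply continuous_profile].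
  - eexists. apply is_RInt_continuous. intros v.
    apply (ex_derive_continuous (K := R_AbsRing) (V := R_NormedModule)). auto_derive. trivial.
  - intros v _. rewrite Rmult_1_l.
    replace (- s * sin v ^ 2) with (fsum n (fun i => - sin v ^ 2 * overlap (f i) M))
      by (rewrite fsum_scal; fold s; ring).
    (* Each factor satisfies [mass - overlap * sin^2 <= 1 - overlap * sin^2 <= exp (- overlap *
       sin^2)]. *)
    rewrite <- fprod_exp. apply fprod_bounds. intros i Hi.
    pose proof (overlap_bounds (f i) M ltac:(auto)) as Ho.
    pose proof (fsum_le_series (f i) (S M) 1 ltac:(auto) ltac:(auto)) as Hm.
    fold (mass (f i) M) in Hm.
    pose proof (SIN_bound v). assert (0 <= sin v ^ 2 <= 1) by nra.
    pose proof (exp_ineq1_le (- sin v ^ 2 * overlap (f i) M)).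
    split; nra.
Qed.

(* Mattner and Roos' bound, obtained here from exact mixtures of uniform distributions. *)
Lemma dTV_shift_law_sum f n :
  (forall i m, (i < n)%nat -> 0 <= f i m) -> (forall i, (i < n)%nat -> is_series (f i) 1) ->
  dTV (law_sum f n) (shift1 (law_sum f n)) <=
    sqrt (2 / PI) * / sqrt (/ 4 + fsum n (fun i => 1 - dTV (f i) (shift1 (f i)))).
Proof.
  intros H0 H1. set (s := fsum n (fun i => 1 - dTV (f i) (shift1 (f i)))).
  set (B := fun x => 2 * (sqrt (2 / PI) * / sqrt (/ 4 + x))).
  apply (Rmult_le_reg_l 2); [lra|].
  assert (Hlim : is_lim_seq (fun M => fsum n (fun i => overlap (f i) M)) s).
  { apply (is_lim_seq_fsum n (fun i => overlap (f i))). intros; apply overlap_lim; auto. }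
  assert (Hs : 0 <= s).
  { apply (is_lim_seq_le (fun _ => 0) _ 0 s) in Hlim; [exact Hlim| |apply is_lim_seq_const].
    intros; apply fsum_nonneg; intros; apply overlap_bounds; auto. }
  apply (is_lim_seq_le (fun M => variation M (law_sum f n))
    (fun M => B (fsum n (fun i => overlap (f i) M)))
    (2 * dTV (law_sum f n) (shift1 (law_sum f n))) (B s)).
  - intros M. now apply variation_law_sum.
  - apply variation_lim; [intros; now apply law_sum_nonneg|now apply is_series_law_sum].
  - apply is_lim_seq_continuous; [|exact Hlim].
    apply continuity_pt_filterlim, (ex_derive_continuous (K := R_AbsRing) (V := R_NormedModule)).
    unfold B. auto_derive. repeat split; [lra|].
    apply Rgt_not_eq, sqrt_lt_R0. lra.
Qed.

(** * Coefficients of the logarithmic derivative *)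

Lemma CV_radius_ge (a : nat -> R) z :
  ex_series (fun m => a m * z ^ m) -> Rbar_le (Rabs z) (CV_radius a).
Proof.
  intros H. apply Rbar_not_lt_le. intros Hlt.
  apply (CV_disk_outside _ _ Hlt). now apply ex_series_lim_0.
Qed.

(** Comparison of power series coefficients in [M' = M G] on a disc around 0. *)
Lemma pgf_recursion f a r :
  ex_series f -> 0 < r ->
  (forall z, Rabs z < r ->
     ex_series (fun m => a (S m) * z ^ m) /\
     is_derive (pgf f) z (pgf f z * Series (fun m => a (S m) * z ^ m))) ->
  forall m, INR (S m) * f (S m) = conv f (fun k => a (S k)) m.
Proof.
  intros Hf Hr H m. set (b := fun k => a (S k)).
  (* Below [r], so that the series of [a] converges at [rho] itself; at most 1, where the series of
     [f] is known to converge. *)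
  set (rho := Rmin (r / 2) 1).
  assert (Hrho : 0 < rho) by (apply Rmin_glb_lt; lra).
  assert (Hrr : rho < r) by (unfold rho; pose proof (Rmin_l (r / 2) 1); lra).
  assert (Hr1 : rho <= 1) by apply Rmin_r.
  assert (Hfr : Rbar_le 1 (CV_radius f)).
  { rewrite <- Rabs_R1. apply CV_radius_ge. apply (ex_series_ext f); [|exact Hf].
    intros n. now rewrite pow1, Rmult_1_r. }
  assert (Hbr : Rbar_le rho (CV_radius b)).
  { rewrite <- (Rabs_pos_eq rho) by lra. apply CV_radius_ge, H. rewrite Rabs_pos_eq; lra. }
  assert (Hin : forall x (c : nat -> R), Rbar_le rho (CV_radius c) -> Rabs x < rho ->
    Rbar_lt (Rabs x) (CV_radius c)).
  { intros x c Hc Hx. eapply Rbar_lt_le_trans; [|exact Hc]. exact Hx. }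
  assert (Hfr' : Rbar_le rho (CV_radius f)) by (eapply Rbar_le_trans; [|exact Hfr]; exact Hr1).
  change (PS_derive f m = conv f b m). rewrite conv_sum_f_R0.
  change (PS_derive f m = PS_mult f b m).
  apply PSeries_ext_recip.
  - rewrite CV_radius_derive. eapply Rbar_lt_le_trans; [|exact Hfr']. exact Hrho.
  (* The Cauchy product is only known to converge strictly inside the common disc. *)
  - apply Rbar_lt_le_trans with (rho / 2); [simpl; lra|].
    rewrite <- (Rabs_pos_eq (rho / 2)) by lra. apply CV_radius_ge.
    apply (ex_series_ext (fun k => scal (pow_n (rho / 2) k) (PS_mult f b k))).
    { intros k. rewrite pow_n_pow. apply Rmult_comm. }
    apply ex_pseries_mult; apply Hin; auto; rewrite Rabs_pos_eq; lra.
  - exists (mkposreal _ Hrho). intros x Hx.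
    assert (Hx' : Rabs x < rho).
    { unfold ball in Hx; simpl in Hx. unfold AbsRing_ball, abs, minus, plus, opp in Hx; simpl in Hx.
      now rewrite Ropp_0, Rplus_0_r in Hx. }
    rewrite PSeries_mult by (apply Hin; auto).
    destruct (H x) as [_ Hd]; [lra|].
    transitivity (pgf f x * Series (fun m => a (S m) * x ^ m)); [|reflexivity].
    rewrite <- (is_derive_unique _ _ _ Hd).
    symmetry. apply is_derive_unique, is_derive_PSeries. now apply Hin.
Qed.

(** Leibniz rule for [z d/dz] on coefficients, from [m = k + (m - k)]. *)
Lemma conv_weight f g m :
  INR m * conv f g m =
  conv (fun k => INR k * f k) g m + conv f (fun k => INR k * g k) m.
Proof.
  unfold conv. rewrite <- fsum_scal, <- fsum_plus. apply fsum_ext; intros k Hk.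
  rewrite minus_INR by lia. ring.
Qed.

Lemma conv_0_l g m : conv (fun _ => 0) g m = 0.
Proof. apply fsum_0; intros; ring. Qed.

Lemma conv_Sr f g m : g 0%nat = 0 -> conv f g (S m) = conv f (fun k => g (S k)) m.
Proof.
  intros H. unfold conv. rewrite fsum_S, Nat.sub_diag, H, Rmult_0_r, Rplus_0_r.
  apply fsum_ext; intros k Hk. now rewrite Nat.sub_succ_l by lia.
Qed.

(* Logarithmic derivatives of generating functions add up. *)
Lemma law_sum_recursion f a n :
  (forall i m, (i < n)%nat -> INR (S m) * f i (S m) = conv (f i) (fun k => a i (S k)) m) ->
  forall m, INR (S m) * law_sum f n (S m) =
    conv (law_sum f n) (fun k => fsum n (fun i => a i (S k))) m.
Proof.
  intros H.
  (* shifted coefficients, so that the recursion reads m f(m) = (f * b)(m) *)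
  set (b := fun i k => match k with O => 0 | S _ => a i k end).
  enough (Hm : forall m, INR m * law_sum f n m =
      conv (law_sum f n) (fun k => fsum n (fun i => b i k)) m).
  { intros m. rewrite Hm, conv_Sr; [reflexivity|]. now apply fsum_0. }
  assert (H' : forall i m, (i < n)%nat -> INR m * f i m = conv (f i) (b i) m).
  { intros i [|m] Hi.
    - unfold conv, fsum; simpl. ring.
    - rewrite H, conv_Sr by easy. reflexivity. }
  clear H. induction n as [|n IH]; intros m.
  - rewrite conv_comm. rewrite (conv_ext _ (fun _ => 0) _ (law_sum f 0)), conv_0_l by reflexivity.
    destruct m; simpl; unfold delta0; simpl; ring.
  - simpl law_sum. rewrite conv_weight.
    rewrite (conv_ext _ (conv (law_sum f n) (fun k => fsum n (fun i => b i k))) _ (f n))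
      by (intros; auto).
    rewrite (conv_ext (law_sum f n) (law_sum f n) _ (conv (f n) (b n))) by (intros; auto).
    rewrite (conv_ext (conv (law_sum f n) (f n)) (conv (law_sum f n) (f n)) _
      (fun k => fsum n (fun i => b i k) + b n k)) by (intros; rewrite ?fsum_S; auto).
    rewrite conv_plus_r, (conv_assoc (law_sum f n) (f n) (b n)). f_equal.
    rewrite !conv_assoc. apply conv_ext; [reflexivity|]. intros; apply conv_comm.
Qed.

(** A summable nonnegative sequence averages a null sequence to a null sequence; this disposes of
    the remainders when convolutions are summed. *)
Lemma conv_vanish f d l :
  (forall m, 0 <= f m) -> is_series f l -> is_lim_seq d 0 ->
  is_lim_seq (conv f d) 0.
Proof.
  intros H0 H1 Hd. pose proof (fun N => fsum_le_series f N l H0 H1) as Hb. rewrite is_series_fsum in H1.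
  apply is_lim_seq_Reals in Hd. apply is_lim_seq_Reals in H1. apply is_lim_seq_Reals.
  destruct (maj_by_pos d) as (W & HW & HdW); [now exists 0|].
  intros eps Heps. assert (Hl : 0 <= l) by (specialize (Hb 0%nat); lra).
  destruct (Hd (eps / 2 / (l + 1))) as [J HJ]; [apply Rdiv_lt_0_compat; lra|].
  destruct (H1 (eps / 2 / W)) as [N HN]; [apply Rdiv_lt_0_compat; lra|].
  exists (N + J)%nat. intros n Hn. unfold R_dist, Rdist in *. rewrite Rminus_0_r.
  unfold conv. replace (S n) with (S n - J + J)%nat by lia. rewrite fsum_add.
  (* For [k < L] the index [n - k] is at least [J], where [d] is small. The last [J] indices lie
     beyond [N], where little mass of [f] is left and [d] is merely bounded by [W]. *)
  set (L := (S n - J)%nat).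
  eapply Rle_lt_trans; [apply Rabs_triang|].
  assert (HA : Rabs (fsum L (fun k => f k * d (n - k)%nat)) <= eps / 2).
  { eapply Rle_trans; [apply fsum_abs|].
    apply Rle_trans with (fsum L (fun k => eps / 2 / (l + 1) * f k)).
    - apply fsum_le; intros k Hk. rewrite Rabs_mult, (Rabs_pos_eq (f k)) by apply H0.
      specialize (HJ (n - k)%nat ltac:(unfold L in Hk; lia)). rewrite Rminus_0_r in HJ.
      specialize (H0 k). nra.
    - rewrite fsum_scal. specialize (Hb L).
      replace (eps / 2) with (eps / 2 / (l + 1) * (l + 1)) at 2 by (field; lra).
      apply Rmult_le_compat_l; [apply Rlt_le, Rdiv_lt_0_compat|]; lra. }
  assert (HB : Rabs (fsum J (fun i => f (L + i)%nat * d (n - (L + i))%nat)) < eps / 2).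
  { eapply Rle_lt_trans; [apply fsum_abs|].
    apply Rle_lt_trans with (W * fsum J (fun i => f (L + i)%nat)).
    - rewrite <- fsum_scal. apply fsum_le; intros k _.
      rewrite Rabs_mult, (Rabs_pos_eq (f _)) by apply H0.
      specialize (H0 (L + k)%nat). specialize (HdW (n - (L + k))%nat). nra.
    - pose proof (fsum_add L J f) as E. pose proof (Hb (L + J)%nat).
      specialize (HN L ltac:(unfold L; lia)). apply Rabs_def2 in HN.
      replace (eps / 2) with (W * (eps / 2 / W)) by (field; lra).
      apply Rmult_lt_compat_l; lra. }
  lra.
Qed.

(* Unlike Mertens' theorem in its usual form, [f] is a probability law and only [b]
   may converge conditionally. *)
Lemma is_series_conv_cond f b l :
  (forall m, 0 <= f m) -> is_series f 1 -> is_series b l ->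
  is_series (conv f b) l.
Proof.
  intros H0 H1 Hb. pose proof (proj1 (is_series_fsum _ _) H1) as H1'.
  rewrite is_series_fsum in Hb |- *.
  set (d := fun n => fsum (S n) b - l).
  assert (Hd : is_lim_seq d 0).
  { unfold d. replace (Finite 0) with (Finite (l - l)) by (f_equal; ring).
    apply is_lim_seq_minus'; [|apply is_lim_seq_const]. now apply is_lim_seq_incr_1 in Hb. }
  apply is_lim_seq_incr_1.
  (* Partial sums of [conv f b] convolve [f] with the partial sums of [b], which are [l + d]. *)
  apply (is_lim_seq_ext (fun n => conv f d n + l * fsum (S n) f)).
  - intros n. unfold conv at 2. rewrite (fsum_triangle (S n) (fun k j => f k * b j)).
    unfold conv. rewrite <- fsum_scal, <- fsum_plus. apply fsum_ext; intros k Hk.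
    rewrite fsum_scal. unfold d. rewrite Nat.sub_succ_l by lia. ring.
  - replace (Finite l) with (Finite (0 + l * 1)) by (f_equal; ring).
    apply is_lim_seq_plus'; [now apply (conv_vanish _ _ 1)|].
    apply (is_lim_seq_scal_l _ l 1). now apply is_lim_seq_incr_1 in H1'.
Qed.

(** Identifies the sum of the coefficients with the mean of [f], by summing the recursion. *)
Lemma is_series_moment f a l :
  (forall m, 0 <= f m) -> is_series f 1 ->
  (forall m, INR (S m) * f (S m) = conv f (fun k => a (S k)) m) ->
  is_series (fun m => a (S m)) l -> is_series (fun m => INR (S m) * f (S m)) l.
Proof.
  intros H0 H1 Hrec Ha. apply (is_series_ext _ _ _ (fun m => eq_sym (Hrec m))).
  now apply is_series_conv_cond.
Qed.

Lemma is_series_nonneg f l : (forall m, 0 <= f m) -> is_series f l -> 0 <= l.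
Proof.
  intros H0 H. rewrite is_series_fsum in H.
  apply (is_lim_seq_le (fun _ => 0) _ 0 l) in H; [exact H| |apply is_lim_seq_const].
  intros; now apply fsum_nonneg.
Qed.

Lemma is_series_zero f : (forall m, 0 <= f m) -> is_series f 0 -> forall m, f m = 0.
Proof.
  intros H0 H m. rewrite is_series_fsum in H.
  assert (fsum (S m) f <= 0).
  { apply (is_lim_seq_incr_compare _ _ H). intros n; rewrite fsum_S. specialize (H0 n). lra. }
  rewrite fsum_S in H1. pose proof (fsum_nonneg m f (fun i _ => H0 i)). specialize (H0 m). lra.
Qed.

(** A nonnegative variable of mean 0 is constantly 0, and the recursion then kills every
    coefficient. This excludes [mu = 0] in the theorem. *)
Lemma zero_mean_coefficients f a :
  (forall m, 0 <= f m) -> is_series f 1 ->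
  (forall m, INR (S m) * f (S m) = conv f (fun k => a (S k)) m) ->
  is_series (fun m => a (S m)) 0 -> forall m, a (S m) = 0.
Proof.
  intros H0 H1 Hrec Ha.
  assert (Hf : forall m, f (S m) = 0).
  { intros m. pose proof (lt_0_INR (S m) ltac:(lia)) as Hm.
    assert (E : INR (S m) * f (S m) = 0).
    { apply (is_series_zero (fun m => INR (S m) * f (S m))).
      - intros; apply Rmult_le_pos; [apply pos_INR|apply H0].
      - eapply is_series_moment; eassumption. }
    nra. }
  assert (Hf0 : f 0%nat = 1).
  { rewrite is_series_fsum in H1. apply is_lim_seq_incr_1 in H1.
    apply is_lim_seq_unique in H1.
    rewrite (Lim_seq_ext _ (fun _ => f 0%nat)), Lim_seq_const in H1; [now inversion H1|].
    intros n. rewrite fsum_Sl, fsum_0; [ring|auto]. }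
  intros m. specialize (Hrec m). rewrite Hf, Rmult_0_r in Hrec.
  unfold conv in Hrec. rewrite fsum_Sl, Hf0, Nat.sub_0_r, fsum_0 in Hrec; [lra|].
  intros i _. rewrite Hf. ring.
Qed.

(** * The negative binomial Stein equation *)

Lemma gbinom_0 a : gbinom a 0 = 1.
Proof. unfold gbinom; simpl. field. Qed.

Lemma gbinom_S a m : INR (S m) * gbinom a (S m) = (a + INR m) * gbinom a m.
Proof.
  unfold gbinom. rewrite seq_S, map_app, fold_right_app, fact_simpl, mult_INR.
  assert (E : forall l x, fold_right Rmult x l = fold_right Rmult 1 l * x).
  { induction l as [|y l IH]; intros x; simpl; [ring|]. rewrite IH. ring. }
  rewrite E. simpl (fold_right _ _ (map _ [0 + m]%nat)). field.
  split; [apply INR_fact_neq_0|apply not_0_INR; lia].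
Qed.

Lemma gbinom_pos a m : 0 < a -> 0 < gbinom a m.
Proof.
  intros Ha. induction m as [|m IH]; [rewrite gbinom_0; lra|].
  pose proof (pos_INR m). pose proof (lt_0_INR (S m) ltac:(lia)) as Hm.
  apply (Rmult_lt_reg_l (INR (S m))); [exact Hm|]. rewrite Rmult_0_r, gbinom_S.
  apply Rmult_lt_0_compat; lra.
Qed.

Lemma is_lim_seq_inv_S : is_lim_seq (fun n => / INR (S n)) 0.
Proof.
  apply (is_lim_seq_inv (fun n => INR (S n)) p_infty); [|easy].
  apply (is_lim_seq_incr_1 INR). apply is_lim_seq_INR.
Qed.

Lemma CV_radius_gbinom a : 0 < a -> CV_radius (gbinom a) = 1.
Proof.
  intros Ha. replace (Finite 1) with (Finite (/ 1)) by (f_equal; field).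
  apply CV_radius_finite_DAlembert; [|lra|].
  - intros n. pose proof (gbinom_pos a n Ha). lra.
  - apply (is_lim_seq_ext (fun n => 1 + (a - 1) * / INR (S n))).
    + intros n. pose proof (gbinom_pos a n Ha). pose proof (lt_0_INR (S n) ltac:(lia)) as Hn.
      assert (E : gbinom a (S n) = (a + INR n) * gbinom a n / INR (S n)).
      { rewrite <- gbinom_S. field. lra. }
      pose proof (pos_INR n).
      rewrite E, Rabs_pos_eq.
      * rewrite S_INR in *. field. lra.
      * apply Rlt_le. apply Rdiv_lt_0_compat; [|lra].
        apply Rdiv_lt_0_compat; [apply Rmult_lt_0_compat; lra|lra].
    + replace (Finite 1) with (Finite (1 + (a - 1) * 0)) by (f_equal; ring).
      apply is_lim_seq_plus'; [apply is_lim_seq_const|].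
      apply (is_lim_seq_scal_l _ (a - 1) 0), is_lim_seq_inv_S.
Qed.

(** Binomial series: the product has derivative 0 and equals 1 at the origin. *)
Lemma PSeries_gbinom a x :
  0 < a -> 0 < x < 1 -> PSeries (gbinom a) x * Rpower (1 - x) a = 1.
Proof.
  intros Ha Hx.
  set (H := fun t => PSeries (gbinom a) t * Rpower (1 - t) a).
  assert (HH : H 0 = H x).
  { apply (eq_is_derive (V := R_NormedModule) H 0 x); [|lra]. intros t Ht.
    assert (Hcv : Rbar_lt (Rabs t) (CV_radius (gbinom a))).
    { rewrite CV_radius_gbinom by exact Ha. rewrite Rabs_pos_eq by lra. simpl; lra. }
    assert (HD := is_derive_PSeries _ _ Hcv).
    (* The recursion [gbinom_S] as a differential equation, [(1 - t) S' = a S]. *)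
    assert (HODE : PSeries (PS_derive (gbinom a)) t - t * PSeries (PS_derive (gbinom a)) t =
      a * PSeries (gbinom a) t).
    { rewrite <- PSeries_incr_1, <- PSeries_scal, <- PSeries_minus.
      - apply PSeries_ext. intros [|n]; unfold PS_minus, PS_plus, PS_opp, PS_scal, PS_incr_1, PS_derive;
          unfold plus, opp, scal; simpl; unfold mult; simpl.
        + pose proof (gbinom_S a 0) as E. simpl in E. unfold zero; simpl. lra.
        + pose proof (gbinom_S a (S n)) as E. simpl in E |- *. lra.
      - now apply ex_pseries_derive.
      - apply ex_pseries_incr_1. now apply ex_pseries_derive. }
    assert (HR : is_derive (fun t => Rpower (1 - t) a) t (- a / (1 - t) * Rpower (1 - t) a)).
    { unfold Rpower. auto_derive; [lra|]. replace (1 + - t) with (1 - t) by ring. field. lra. }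
    unfold H. evar_last.
    { apply (is_derive_mult (K := R_AbsRing)); [exact HD|exact HR|]. intros; apply Rmult_comm. }
    unfold plus, mult, zero; simpl.
    replace (PSeries (PS_derive (gbinom a)) t) with (a * PSeries (gbinom a) t / (1 - t)).
    - field. lra.
    - rewrite <- HODE. field. lra. }
  unfold H in HH. rewrite <- HH, PSeries_0, gbinom_0, Rminus_0_r. unfold Rpower.
  rewrite ln_1, Rmult_0_r, exp_0. ring.
Qed.

Lemma is_series_nb_pmf alpha p : 0 < alpha -> 0 < p < 1 -> is_series (nb_pmf alpha p) 1.
Proof.
  intros Ha Hp.
  assert (Hex : ex_series (fun m => gbinom alpha m * (1 - p) ^ m)).
  { assert (Hcv : Rbar_lt (Rabs (1 - p)) (CV_radius (gbinom alpha))).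
    { rewrite CV_radius_gbinom by exact Ha. rewrite Rabs_pos_eq by lra. simpl; lra. }
    apply CV_radius_inside in Hcv.
    apply (ex_series_ext (fun k => scal (pow_n (1 - p) k) (gbinom alpha k))); [|exact Hcv].
    intros k. rewrite pow_n_pow. apply Rmult_comm. }
  pose proof (PSeries_gbinom alpha (1 - p) Ha ltac:(lra)) as E.
  replace (1 - (1 - p)) with p in E by ring. rewrite <- E, Rmult_comm.
  apply (is_series_ext (fun m => Rpower p alpha * (gbinom alpha m * (1 - p) ^ m))).
  - intros m. unfold nb_pmf. apply Rminus_diag_uniq. ring.
  - apply (is_series_scal (K := R_AbsRing) (V := R_NormedModule)). now apply Series_correct.
Qed.

Lemma nb_pmf_pos alpha p m : 0 < alpha -> 0 < p < 1 -> 0 < nb_pmf alpha p m.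
Proof.
  intros Ha Hp. unfold nb_pmf. apply Rmult_lt_0_compat; [apply Rmult_lt_0_compat|].
  - now apply gbinom_pos.
  - apply exp_pos.
  - apply pow_lt; lra.
Qed.

Lemma nb_pmf_S alpha p m :
  INR (S m) * nb_pmf alpha p (S m) = (1 - p) * (alpha + INR m) * nb_pmf alpha p m.
Proof.
  unfold nb_pmf. rewrite <- !Rmult_assoc, gbinom_S. simpl pow. ring.
Qed.

Lemma is_lim_seq_fsum_tail (F : nat -> R) l k :
  is_series F l -> is_lim_seq (fun N => fsum N (fun i => F (k + i)%nat)) (l - fsum k F).
Proof.
  intros H. rewrite is_series_fsum in H. apply (is_lim_seq_incr_n _ k) in H.
  apply (is_lim_seq_ext (fun N => fsum (N + k) F - fsum k F)).
  - intros N. rewrite Nat.add_comm, fsum_add. ring.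
  - apply is_lim_seq_minus'; [exact H|apply is_lim_seq_const].
Qed.

(* Solution of the Stein equation q(alpha + k) g(k+1) - k g(k) = phi k - c;
   the value at 0 is arbitrary. *)
Definition stein (alpha q : R) (z phi : nat -> R) (c : R) (k : nat) : R :=
  match k with
  | O => 0
  | S j => fsum k (fun i => (phi i - c) * z i) / (q * (alpha + INR j) * z j)
  end.

Section SteinSolution.

Variables (alpha q : R) (z phi : nat -> R) (c : R).
Hypothesis (Halpha : 0 < alpha) (Hq : 0 < q < 1) (Hz : forall m, 0 < z m).
Hypothesis (Hrec : forall m, INR (S m) * z (S m) = q * (alpha + INR m) * z m).
Hypothesis (Hsum : is_series z 1).
Hypothesis (Hphi : forall m, 0 <= phi m <= 1) (Hc : is_series (fun m => phi m * z m) c).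

Let g := stein alpha q z phi c.
Let P k := fsum k z.
Let L k := fsum k (fun i => phi i * z i).

Lemma rate_pos k : 0 < q * (alpha + INR k).
Proof. pose proof (pos_INR k). apply Rmult_lt_0_compat; lra. Qed.

Lemma stein_equation k : q * (alpha + INR k) * g (S k) - INR k * g k = phi k - c.
Proof.
  pose proof (rate_pos k). pose proof (Hz k). unfold g, stein. rewrite fsum_S.
  destruct k as [|j].
  - unfold fsum; simpl fold_right. simpl INR in *. field. repeat split; lra.
  - rewrite <- (Hrec j). pose proof (lt_0_INR (S j) ltac:(lia)). field. repeat split; lra.
Qed.

Lemma stein_S k : g (S k) = (L (S k) - c * P (S k)) / (q * (alpha + INR k) * z k).
Proof.
  unfold g, stein, L, P. rewrite <- fsum_scal, <- fsum_minus. f_equal.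
  apply fsum_ext; intros; ring.
Qed.

Lemma P_le_1 k : 0 <= P k <= 1.
Proof. apply fsum_le_series; [intros; apply Rlt_le, Hz|exact Hsum]. Qed.

Lemma L_bounds k : 0 <= L k <= P k.
Proof.
  split; [apply fsum_nonneg|apply fsum_le]; intros i _; specialize (Hphi i); specialize (Hz i); nra.
Qed.

Lemma tail_bounds k : 0 <= c - L k <= 1 - P k.
Proof.
  split.
  - apply (is_lim_seq_le (fun _ => 0) _ 0 (c - L k)) with (2 := is_lim_seq_const 0)
      (3 := is_lim_seq_fsum_tail _ c k Hc).
    intros; apply fsum_nonneg; intros. specialize (Hphi (k + i)%nat). specialize (Hz (k + i)%nat). nra.
  - apply (is_lim_seq_le _ _ (c - L k) (1 - P k)) with (2 := is_lim_seq_fsum_tail _ c k Hc)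
      (3 := is_lim_seq_fsum_tail _ 1 k Hsum).
    intros; apply fsum_le; intros. specialize (Hphi (k + i)%nat). specialize (Hz (k + i)%nat). nra.
Qed.

(** Write [q (alpha + k) = q (alpha + j) + q (k - j)] against [z j]: the recursion rewrites the
    first part, [q <= 1] bounds the second, and [j + (k - j) = k] reassembles the sum. *)
Lemma head_monotone k : q * (alpha + INR k) * P k <= INR k * P (S k).
Proof.
  apply Rle_trans with (fsum k (fun j => INR (S j) * z (S j)) + fsum (S k) (fun j => (INR k - INR j) * z j)).
  - rewrite (fsum_S k), Rminus_diag, Rmult_0_l, Rplus_0_r, <- fsum_plus. unfold P.
    rewrite <- fsum_scal. apply fsum_le; intros j Hj. rewrite Hrec. apply lt_INR in Hj.
    specialize (Hz j). assert (q * (INR k - INR j) * z j <= 1 * (INR k - INR j) * z j) by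
      (repeat apply Rmult_le_compat_r; lra). lra.
  - right. transitivity (fsum (S k) (fun j => INR j * z j) + fsum (S k) (fun j => (INR k - INR j) * z j)).
    + rewrite (fsum_Sl k (fun j => INR j * z j)). simpl (INR 0). ring.
    + rewrite <- fsum_plus. unfold P. rewrite <- fsum_scal. apply fsum_ext; intros; ring.
Qed.

(** Holds termwise after the recursion, since [(k + i + 1)(alpha + k) - k (alpha + k + i) = (i + 1)
    alpha + k]. *)
Lemma tail_monotone k : INR k * (1 - P (S k)) <= q * (alpha + INR k) * (1 - P k).
Proof.
  apply (is_lim_seq_le (fun N => INR k * fsum N (fun i => z (S k + i)%nat))
    (fun N => q * (alpha + INR k) * fsum N (fun i => z (k + i)%nat))
    (INR k * (1 - P (S k))) (q * (alpha + INR k) * (1 - P k))).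
  - intros N. rewrite <- !fsum_scal. apply fsum_le; intros i _.
    change (S k + i)%nat with (S (k + i)).
    pose proof (lt_0_INR (S (k + i)) ltac:(lia)) as Hp.
    apply (Rmult_le_reg_l (INR (S (k + i)))); [exact Hp|].
    replace (INR (S (k + i)) * (INR k * z (S (k + i))))
      with (INR k * (INR (S (k + i)) * z (S (k + i)))) by ring.
    rewrite Hrec. pose proof (Hz (k + i)%nat). rewrite S_INR, plus_INR.
    pose proof (pos_INR k). pose proof (pos_INR i).
    assert (INR k * (alpha + (INR k + INR i)) <= (INR k + INR i + 1) * (alpha + INR k)) by nra.
    assert (0 < q * z (k + i)%nat) by (apply Rmult_lt_0_compat; lra). nra.
  - apply (is_lim_seq_scal_l _ (INR k) (1 - P (S k))). now apply is_lim_seq_fsum_tail.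
  - apply (is_lim_seq_scal_l _ (q * (alpha + INR k)) (1 - P k)). now apply is_lim_seq_fsum_tail.
Qed.

(** The increment at [k] is linear in [phi], with positive weight at [k] and nonpositive weights
    elsewhere. The weights balance, so its size is at most the increment [A + B] for the indicator
    of [k]. *)
Lemma stein_diff_bound k : (1 <= k)%nat -> Rabs (g (S k) - g k) <= / (alpha * q).
Proof.
  intros Hk. destruct k as [|j]; [lia|]. set (k := S j) in *.
  assert (E1 : g (S k) = (L (S k) - c * P (S k)) / (q * (alpha + INR k) * z k)) by apply stein_S.
  assert (E0 : g k = (L k - c * P k) / (INR k * z k)).
  { unfold k at 1. rewrite (stein_S j), <- (Hrec j). reflexivity. }
  rewrite E1, E0. clear E1 E0.
  pose proof (rate_pos k) as Hb. set (b := q * (alpha + INR k)) in *.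
  pose proof (lt_0_INR k ltac:(lia)) as Hk0.
  pose proof (head_monotone k) as Hh. pose proof (tail_monotone k) as Ht. fold b in Hh, Ht.
  pose proof (P_le_1 k) as HP. pose proof (P_le_1 (S k)) as HP'.
  pose proof (L_bounds k) as HL. pose proof (tail_bounds (S k)) as HU.
  assert (EP : P (S k) = P k + z k) by apply fsum_S.
  assert (EL : L (S k) = L k + phi k * z k) by apply fsum_S.
  specialize (Hphi k). specialize (Hz k).
  set (m := INR k) in *. set (zk := z k) in *.
  set (A := (1 - P (S k)) / b). set (B := P k / m).
  (* the increment of the solution for the indicator of {k} *)
  assert (HAB : 0 <= A /\ 0 <= B /\ A + B <= / (alpha * q)).
  { assert (0 <= A) by (apply Rdiv_le_0_compat; lra).
    assert (0 <= B) by (apply Rdiv_le_0_compat; lra).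
    split; [assumption|]. split; [assumption|].
    (* From [head_monotone]; hence [A + B] is at most [(1 - P (S k) + P (S k)) / b = 1 / b]. *)
    assert (HB : B <= P (S k) / b).
    { apply (Rmult_le_reg_r (m * b)); [apply Rmult_lt_0_compat; lra|].
      unfold B. replace (P k / m * (m * b)) with (b * P k) by (field; lra).
      replace (P (S k) / b * (m * b)) with (m * P (S k)) by (field; lra). exact Hh. }
    assert (HA : A + P (S k) / b = / b) by (unfold A; field; lra).
    assert (/ b <= / (alpha * q)).
    { apply Rinv_le_contravar; [apply Rmult_lt_0_compat; lra|]. unfold b. assert (0 < q * m) by (apply Rmult_lt_0_compat; lra). lra. }
    lra. }
  set (c1 := A - (1 - P k) / m). set (c3 := B - P (S k) / b).
  assert (Hc1 : c1 <= 0).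
  { apply (Rmult_le_reg_r (m * b)); [apply Rmult_lt_0_compat; lra|].
    unfold c1, A. replace (((1 - P (S k)) / b - (1 - P k) / m) * (m * b))
      with (m * (1 - P (S k)) - b * (1 - P k)) by (field; lra). lra. }
  assert (Hc3 : c3 <= 0).
  { apply (Rmult_le_reg_r (m * b)); [apply Rmult_lt_0_compat; lra|].
    unfold c3, B. replace ((P k / m - P (S k) / b) * (m * b))
      with (b * P k - m * P (S k)) by (field; lra). lra. }
  set (U := c - L (S k)) in *.
  set (D := (L (S k) - c * P (S k)) / (b * zk) - (L k - c * P k) / (m * zk)).
  (* The three terms collect [phi] below [k], at [k] and above [k]; [U] is the part above. *)
  assert (E : D * zk =
    L k * c1 + phi k * zk * (A + B) + U * c3).
  { unfold D, c1, c3, A, B. replace c with (U + L (S k)) by (unfold U; ring).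
    rewrite EL, EP. fold zk. field. lra. }
  (* The balance of weights: for [phi = 1] the solution is 0, so its increment vanishes. *)
  assert (E2 : P k * c1 + (1 - P (S k)) * c3 = - zk * (A + B)).
  { unfold c1, c3, A, B. rewrite EP. fold zk. field. lra. }
  assert (HD : Rabs (D * zk) <= zk * (A + B)).
  { rewrite E. apply Rabs_le. split.
    - assert (P k * c1 <= L k * c1) by
        (rewrite !(Rmult_comm _ c1); apply Rmult_le_compat_neg_l; lra).
      assert ((1 - P (S k)) * c3 <= U * c3) by
        (rewrite !(Rmult_comm _ c3); apply Rmult_le_compat_neg_l; lra).
      assert (0 <= phi k * zk * (A + B)) by (repeat apply Rmult_le_pos; lra). lra.
    - pose proof (Rmult_le_compat_neg_l c1 0 (L k) Hc1 ltac:(lra)).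
      pose proof (Rmult_le_compat_neg_l c3 0 U Hc3 ltac:(lra)).
      assert (phi k * (zk * (A + B)) <= 1 * (zk * (A + B))) by
        (apply Rmult_le_compat_r; [apply Rmult_le_pos; lra|lra]). lra. }
  rewrite Rabs_mult, (Rabs_pos_eq zk) in HD by lra.
  assert (Rabs D <= A + B) by (apply (Rmult_le_reg_r zk); [exact Hz|rewrite (Rmult_comm (A + B)); exact HD]).
  fold D. lra.
Qed.

(** A qualitative bound for the convergence of expectations: the tail ratio bounding [|g (S k)|] is
    nonincreasing by [tail_monotone], hence largest at [k = 0]. *)
Lemma stein_bounded : exists G, forall k, Rabs (g k) <= G.
Proof.
  set (G := (1 - P 1) / (q * (alpha + INR 0) * z 0%nat)).
  assert (HG : forall k, (1 - P (S k)) / (q * (alpha + INR k) * z k) <= G).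
  { induction k as [|k IH]; [apply Rle_refl|].
    eapply Rle_trans; [|exact IH]. rewrite <- (Hrec k).
    pose proof (tail_monotone (S k)). pose proof (rate_pos (S k)).
    pose proof (lt_0_INR (S k) ltac:(lia)). pose proof (Hz (S k)).
    set (b := q * (alpha + INR (S k))) in *.
    apply (Rmult_le_reg_r (b * z (S k) * INR (S k))); [repeat apply Rmult_lt_0_compat; lra|].
    replace ((1 - P (S (S k))) / (b * z (S k)) * (b * z (S k) * INR (S k)))
      with (INR (S k) * (1 - P (S (S k)))) by (field; lra).
    replace ((1 - P (S k)) / (INR (S k) * z (S k)) * (b * z (S k) * INR (S k)))
      with (b * (1 - P (S k))) by (field; lra). assumption. }
  exists G. intros [|k].
  - simpl. rewrite Rabs_R0. apply Rdiv_le_0_compat; [pose proof (P_le_1 1); lra|].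
    apply Rmult_lt_0_compat; [apply rate_pos|apply Hz].
  - eapply Rle_trans; [|apply (HG k)]. rewrite stein_S.
    pose proof (rate_pos k). pose proof (Hz k).
    assert (Hp : 0 < q * (alpha + INR k) * z k) by (apply Rmult_lt_0_compat; lra).
    unfold Rdiv. rewrite Rabs_mult, (Rabs_pos_eq (/ _)) by (apply Rlt_le, Rinv_0_lt_compat, Hp).
    apply Rmult_le_compat_r; [apply Rlt_le, Rinv_0_lt_compat, Hp|].
    pose proof (L_bounds (S k)). pose proof (tail_bounds (S k)). pose proof (P_le_1 (S k)).
    set (l := L (S k)) in *. set (p := P (S k)) in *.
    (* Both products lie between 0 and [1 - p], because [l <= p <= 1] and [c - l <= 1 - p]. *)
    replace (l - c * p) with (l * (1 - p) - (c - l) * p) by ring.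
    apply Rabs_le. split; nra.
Qed.

End SteinSolution.

(** * Comparison of the Stein operators *)

Lemma ex_series_dominated (u v : nat -> R) :
  (forall k, Rabs (u k) <= v k) -> ex_series v -> ex_series u.
Proof. intros H. apply (ex_series_le (K := R_AbsRing) (V := R_CompleteNormedModule)), H. Qed.

Lemma ex_series_mult_bounded u w W :
  ex_series (fun k => Rabs (u k)) -> (forall k, Rabs (w k) <= W) ->
  ex_series (fun k => u k * w k).
Proof.
  intros Hu Hw. apply (ex_series_dominated _ (fun k => Rabs (u k) * W)).
  - intros k. rewrite Rabs_mult. apply Rmult_le_compat_l; [apply Rabs_pos|apply Hw].
  - now apply ex_series_scal_r.
Qed.

Lemma is_series_Rabs_le u v l s :
  (forall k, Rabs (u k) <= v k) -> is_series u l -> is_series v s -> Rabs l <= s.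
Proof.
  intros H Hu Hv. rewrite is_series_fsum in Hu, Hv.
  apply is_lim_seq_abs in Hu. simpl in Hu.
  apply (is_lim_seq_le _ _ (Rabs l) s) with (2 := Hu) (3 := Hv).
  intros N. eapply Rle_trans; [apply fsum_abs|]. apply fsum_le; intros; apply H.
Qed.

(** Interchange of summation for absolutely summable [u], a law [h] and bounded [w], with the
    remainder handled by [conv_vanish]. *)
Lemma is_series_conv_pairing u h w W :
  ex_series (fun k => Rabs (u k)) -> (forall m, 0 <= h m) -> is_series h 1 ->
  (forall m, Rabs (w m) <= W) ->
  is_series (fun m => w m * conv u h m)
    (Series (fun k => u k * Series (fun j => h j * w (k + j)%nat))).
Proof.
  intros [s Hu] Hh Hh1 Hw.
  set (e := fun k => Series (fun j => h j * w (k + j)%nat)).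
  assert (Hhw : forall k, is_series (fun j => h j * w (k + j)%nat) (e k)).
  { intros k. apply Series_correct, (ex_series_mult_bounded _ _ W); [|intros; apply Hw].
    exists 1. apply (is_series_ext h); [|exact Hh1]. intros; now rewrite Rabs_pos_eq by apply Hh. }
  assert (He : forall k, Rabs (e k) <= 1 * W).
  { intros k.
    refine (is_series_Rabs_le _ (fun j => h j * W) _ _ _ (Hhw k) (is_series_scal_r W _ _ Hh1)).
    intros j. rewrite Rabs_mult, (Rabs_pos_eq (h j)) by apply Hh.
    apply Rmult_le_compat_l; [apply Hh|apply Hw]. }
  assert (Hue : is_series (fun k => u k * e k) (Series (fun k => u k * e k))).
  { apply Series_correct, (ex_series_mult_bounded _ _ (1 * W)); [now exists s|exact He]. }
  set (T := Series _) in *.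
  set (d := fun n => 1 - fsum (S n) h).
  assert (Hd : is_lim_seq d 0).
  { unfold d. replace (Finite 0) with (Finite (1 - 1)) by (f_equal; ring).
    apply is_lim_seq_minus'; [apply is_lim_seq_const|].
    apply is_series_fsum, is_lim_seq_incr_1 in Hh1. exact Hh1. }
  pose proof (conv_vanish _ d s (fun k => Rabs_pos (u k)) Hu Hd) as Hv.
  apply is_series_fsum, is_lim_seq_incr_1 in Hue. apply is_series_fsum, is_lim_seq_incr_1.
  apply (is_lim_seq_ext (fun N => fsum (S N) (fun k => u k * e k) -
    (fsum (S N) (fun k => u k * e k) - fsum (S N) (fun m => w m * conv u h m)))); [intros; ring|].
  replace (Finite T) with (Finite (T - 0)) by (f_equal; ring).
  apply is_lim_seq_minus'; [exact Hue|].
  apply is_lim_seq_abs_0.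
  apply (is_lim_seq_le_le (fun _ => 0) _ (fun N => W * conv (fun k => Rabs (u k)) d N)).
  2: apply is_lim_seq_const.
  2:{ replace (Finite 0) with (Finite (W * 0)) by (f_equal; ring).
      apply (is_lim_seq_scal_l _ W 0), Hv. }
  (* Over the triangle, row [k] misses a tail of the series [e k], which is at most [W] times the
     tail [d (N - k)] of [h]. *)
  intros N. split; [apply Rabs_pos|].
  rewrite (fsum_ext (S N) (fun m => w m * conv u h m)
    (fun m => fsum (S m) (fun k => (fun k j => u k * (h j * w (k + j)%nat)) k (m - k)%nat))).
  2:{ intros m _. unfold conv. rewrite <- fsum_scal. apply fsum_ext; intros k Hk.
      replace (k + (m - k))%nat with m by lia. ring. }
  rewrite (fsum_triangle (S N) (fun k j => u k * (h j * w (k + j)%nat))), <- fsum_minus.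
  eapply Rle_trans; [apply fsum_abs|]. unfold conv. rewrite <- fsum_scal.
  apply fsum_le; intros k Hk. rewrite fsum_scal, <- Rmult_minus_distr_l, Rabs_mult.
  replace (W * (Rabs (u k) * d (N - k)%nat)) with (Rabs (u k) * (d (N - k)%nat * W)) by ring.
  apply Rmult_le_compat_l; [apply Rabs_pos|].
  replace (S N - k)%nat with (S (N - k)) by lia. set (n := S (N - k)).
  assert (Hdn : d (N - k)%nat = 1 - fsum n h) by reflexivity. rewrite Hdn.
  pose proof (is_lim_seq_fsum_tail _ _ n (Hhw k)) as H1.
  pose proof (is_lim_seq_fsum_tail _ _ n Hh1) as H2.
  apply is_lim_seq_abs in H1.
  apply (is_lim_seq_scal_r _ W) in H2.
  refine (is_lim_seq_le _ _ (Finite _) (Finite _) _ H1 H2).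
  intros M. eapply Rle_trans; [apply fsum_abs|]. rewrite Rmult_comm, <- fsum_scal.
  apply fsum_le; intros i _. rewrite Rabs_mult, (Rabs_pos_eq (h _)), Rmult_comm by apply Hh.
  apply Rmult_le_compat_r; [apply Hh|apply Hw].
Qed.

(** Discrete Taylor formula, by summing twice; [k (k - 1) / 2] is the source of the weight
    [l (l - 1)] in the theorem. *)
Lemma second_difference (e : nat -> R) eps :
  (forall k, Rabs (e (S (S k)) - 2 * e (S k) + e k) <= eps) ->
  forall k, Rabs (e (S k) - e k - (e 1%nat - e 0%nat)) <= INR k * eps /\
    Rabs (e k - e 0%nat - INR k * (e 1%nat - e 0%nat)) <= INR k * (INR k - 1) / 2 * eps.
Proof.
  intros H k. induction k as [|k [IH1 IH2]].
  - simpl. rewrite !Rmult_0_l, Rminus_0_r, !Rminus_diag.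
    unfold Rdiv. rewrite !Rmult_0_l, Rabs_R0. lra.
  - rewrite S_INR. specialize (H k). split.
    + replace (e (S (S k)) - e (S k) - (e 1%nat - e 0%nat))
        with ((e (S (S k)) - 2 * e (S k) + e k) + (e (S k) - e k - (e 1%nat - e 0%nat))) by ring.
      eapply Rle_trans; [apply Rabs_triang|]. lra.
    + replace (e (S k) - e 0%nat - (INR k + 1) * (e 1%nat - e 0%nat))
        with ((e (S k) - e k - (e 1%nat - e 0%nat)) + (e k - e 0%nat - INR k * (e 1%nat - e 0%nat)))
        by ring.
      eapply Rle_trans; [apply Rabs_triang|]. lra.
Qed.

Lemma is_series_decr (u : nat -> R) l : is_series (fun k => u (S k)) l -> is_series u (u 0%nat + l).
Proof.
  rewrite !is_series_fsum. intros H. apply is_lim_seq_incr_1.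
  apply (is_lim_seq_ext (fun n => u 0%nat + fsum n (fun k => u (S k)))).
  - intros; now rewrite fsum_Sl.
  - apply is_lim_seq_plus'; [apply is_lim_seq_const|exact H].
Qed.

Lemma is_series_incr (u : nat -> R) l : is_series u l -> is_series (fun k => u (S k)) (l - u 0%nat).
Proof.
  rewrite !is_series_fsum. intros H. apply is_lim_seq_incr_1 in H.
  apply (is_lim_seq_ext (fun n => fsum (S n) u - u 0%nat)).
  - intros; rewrite fsum_Sl; ring.
  - apply is_lim_seq_minus'; [exact H|apply is_lim_seq_const].
Qed.

Section SteinComparison.

Variables (h A g : nat -> R) (alpha q mu mu2 G D : R).
Hypothesis (Hh : forall m, 0 <= h m) (Hh1 : is_series h 1).
Hypothesis (Hrec : forall m, INR (S m) * h (S m) = conv h (fun k => A (S k)) m).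
Hypothesis (HA : ex_series (fun k => Rabs (A (S k)))).
Hypothesis (Hmu : is_series (fun m => A (S m)) mu).
Hypothesis (Hmu2 : is_series (fun m => INR m * A (S m)) mu2).
Hypothesis (Hc : ex_series (fun l => INR l * INR (l - 1) * Rabs (A (S l) - q * A l))).
Hypothesis (Hmean : q * alpha = (1 - q) * mu) (Hvar : q * (mu + mu2) = mu2).
Hypothesis (Hg : forall k, Rabs (g k) <= G).
Hypothesis (HD : forall k, (1 <= k)%nat -> Rabs (g (S k) - g k) <= D).

Let e k := Series (fun j => h j * g (S (k + j))).

Lemma is_series_expectation w W k :
  (forall m, Rabs (w m) <= W) ->
  is_series (fun j => h j * w (k + j)%nat) (Series (fun j => h j * w (k + j)%nat)).
Proof.
  intros Hw. apply Series_correct, (ex_series_mult_bounded _ _ W); [|intros; apply Hw].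
  exists 1. apply (is_series_ext h); [|exact Hh1]. intros; now rewrite Rabs_pos_eq by apply Hh.
Qed.

Lemma is_series_e k : is_series (fun j => h j * g (S (k + j))) (e k).
Proof. apply (is_series_expectation (fun m => g (S m)) G). intros; apply Hg. Qed.

(** One difference stays on [g] and costs [D]; the other is moved onto [h] by shifting the summation
    index, and costs the total variation of [h]. *)
Lemma second_difference_e k :
  Rabs (e (S (S k)) - 2 * e (S k) + e k) <= D * (2 * dTV h (shift1 h)).
Proof.
  set (delta := fun m => g (S (S (k + m))) - g (S (k + m))).
  assert (Hdelta : forall m, Rabs (delta m) <= D) by (intros; apply HD; lia).
  assert (H1 : is_series (fun j => h j * delta j) (e (S k) - e k)).
  { apply (is_series_ext (fun j => h j * g (S (S k + j)) - h j * g (S (k + j)))).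
    - intros j. unfold delta. rewrite Nat.add_succ_l. apply Rminus_diag_uniq; ring.
    - apply (is_series_minus (K := R_AbsRing) (V := R_NormedModule)); apply is_series_e. }
  assert (H2 : is_series (fun j => shift1 h j * delta j) (e (S (S k)) - e (S k))).
  { apply is_series_fsum, is_lim_seq_incr_1.
    apply (is_lim_seq_ext (fun n => fsum n (fun j => h j * g (S (S (S k) + j)) - h j * g (S (S k + j))))).
    - intros n. rewrite fsum_Sl. simpl shift1. rewrite Rmult_0_l, Rplus_0_l.
      apply fsum_ext; intros j _. unfold delta.
      replace (k + S j)%nat with (S k + j)%nat by lia. simpl. ring.
    - apply is_series_fsum.
      apply (is_series_minus (K := R_AbsRing) (V := R_NormedModule)); apply is_series_e. }
  assert (H3 : is_series (fun j => D * Rabs (h j - shift1 h j)) (D * (2 * dTV h (shift1 h)))).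
  { apply (is_series_scal (K := R_AbsRing) (V := R_NormedModule) D).
    unfold dTV. rewrite <- Rmult_assoc, Rinv_r, Rmult_1_l by lra.
    apply Series_correct, ex_series_dist; [exact Hh|intros; now apply shift1_nonneg|now exists 1|].
    exists 1; now apply is_series_shift1. }
  apply (is_series_Rabs_le (fun j => shift1 h j * delta j - h j * delta j) _ _ _) with (3 := H3).
  - intros j. rewrite <- Rmult_minus_distr_r, Rabs_mult, Rmult_comm, (Rabs_minus_sym (shift1 h j)).
    apply Rmult_le_compat_r; [apply Rabs_pos|apply Hdelta].
  - replace (e (S (S k)) - 2 * e (S k) + e k) with (e (S (S k)) - e (S k) - (e (S k) - e k)) by ring.
    now apply (is_series_minus (K := R_AbsRing) (V := R_NormedModule)).
Qed.

(* E[Y w(Y)] = sum_k A_{k+1} E[w(Y + k + 1)] *)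
Lemma is_series_size_bias w W :
  (forall m, Rabs (w m) <= W) ->
  is_series (fun m => INR m * h m * w m)
    (Series (fun k => A (S k) * Series (fun j => h j * w (S (k + j))))).
Proof.
  intros Hw.
  pose proof (is_series_conv_pairing (fun k => A (S k)) h (fun m => w (S m)) W HA Hh Hh1
    (fun m => Hw (S m))) as H.
  apply (is_series_ext _ (fun m => INR (S m) * h (S m) * w (S m))) in H.
  - apply (is_series_decr (fun m => INR m * h m * w m)) in H.
    rewrite Rmult_0_l, Rmult_0_l, Rplus_0_l in H. exact H.
  - intros m. rewrite Hrec, conv_comm. apply Rmult_comm.
Qed.

(** After size biasing, [l] is a combination of the [e k] in which the affine part of [e] cancels,
    leaving the Taylor remainder [r]. *)
Lemma stein_comparison l :
  is_series (fun m => h m * (q * (alpha + INR m) * g (S m) - INR m * g m)) l ->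
  Rabs l <= D * dTV h (shift1 h) *
    Series (fun l => INR l * INR (l - 1) * Rabs (A (S l) - q * A l)).
Proof.
  intros Hl.
  assert (He : forall k, Rabs (e k) <= 1 * G).
  { intros k. apply (is_series_Rabs_le (fun j => h j * g (S (k + j))) (fun j => h j * G)).
    - intros j. rewrite Rabs_mult, (Rabs_pos_eq (h j)) by apply Hh.
      apply Rmult_le_compat_l; [apply Hh|apply Hg].
    - apply is_series_e.
    - now apply is_series_scal_r. }
  set (S1 := Series (fun k => A (S k) * e k)).
  set (S2 := Series (fun k => A (S k) * e (S k))).
  assert (H1 : is_series (fun m => INR m * h m * g m) S1) by (apply (is_series_size_bias g G), Hg).
  assert (H2 : is_series (fun m => INR m * h m * g (S m)) S2)
    by (apply (is_series_size_bias (fun m => g (S m)) G); intros; apply Hg).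
  assert (HS1 : is_series (fun k => A (S k) * e k) S1)
    by (apply Series_correct, (ex_series_mult_bounded _ _ (1 * G)); auto).
  assert (HS2 : is_series (fun k => A (S k) * e (S k)) S2)
    by (apply Series_correct, (ex_series_mult_bounded _ _ (1 * G)); auto).
  assert (El : l = q * alpha * e 0%nat + q * S2 - S1).
  { apply is_series_unique in Hl. rewrite <- Hl. apply is_series_unique.
    apply (is_series_ext (fun m => q * alpha * (h m * g (S m)) + q * (INR m * h m * g (S m))
      - INR m * h m * g m)); [intros m; apply Rminus_diag_uniq; ring|].
    apply (is_series_minus (K := R_AbsRing) (V := R_NormedModule)); [|exact H1].
    apply (is_series_plus (K := R_AbsRing) (V := R_NormedModule)).
    - apply (is_series_scal (K := R_AbsRing) (V := R_NormedModule) (q * alpha)), (is_series_e 0).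
    - apply (is_series_scal (K := R_AbsRing) (V := R_NormedModule) q), H2. }
  (* Coefficient of [e (S k)] in [q S2 - S1]; the remaining [e 0] terms are accounted for in
     [G3]. *)
  set (gam := fun k => q * A (S k) - A (S (S k))).
  assert (G0 : is_series gam (q * mu - (mu - A 1%nat))).
  { apply (is_series_minus (K := R_AbsRing) (V := R_NormedModule)).
    - now apply (is_series_scal (K := R_AbsRing) (V := R_NormedModule) q).
    - apply (is_series_incr (fun m => A (S m)) _ Hmu). }
  (* Linear functions are annihilated: this is the variance matching [Hvar]. *)
  assert (G1 : is_series (fun k => INR (S k) * gam k) 0).
  { replace 0 with (q * (mu2 + mu) - (mu2 - INR 0 * A 1%nat)) by (simpl; lra).
    apply (is_series_ext (fun k => q * (INR k * A (S k) + A (S k)) - INR (S k) * A (S (S k)))).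
    { intros k. unfold gam. rewrite S_INR. apply Rminus_diag_uniq; ring. }
    apply (is_series_minus (K := R_AbsRing) (V := R_NormedModule)).
    - apply (is_series_scal (K := R_AbsRing) (V := R_NormedModule) q).
      now apply (is_series_plus (K := R_AbsRing) (V := R_NormedModule)).
    - apply (is_series_incr (fun m => INR m * A (S m)) _ Hmu2). }
  assert (G2 : is_series (fun k => gam k * e (S k)) (q * S2 - (S1 - A 1%nat * e 0%nat))).
  { apply (is_series_ext (fun k => q * (A (S k) * e (S k)) - A (S (S k)) * e (S k))).
    { intros k. unfold gam. apply Rminus_diag_uniq; ring. }
    apply (is_series_minus (K := R_AbsRing) (V := R_NormedModule)).
    - apply (is_series_scal (K := R_AbsRing) (V := R_NormedModule) q), HS2.
    - apply (is_series_incr (fun k => A (S k) * e k) _ HS1). }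
  set (r := fun k => e k - e 0%nat - INR k * (e 1%nat - e 0%nat)).
  assert (G3 : is_series (fun k => gam k * r (S k)) l).
  { replace l with (q * S2 - (S1 - A 1%nat * e 0%nat) - (e 0%nat * (q * mu - (mu - A 1%nat)))
      - (e 1%nat - e 0%nat) * 0).
    (* Constants cancel by mean matching: [q alpha e 0] supplies the missing [(1 - q) mu e 0]. *)
    2:{ rewrite El, Hmean. ring. }
    apply (is_series_ext (fun k => gam k * e (S k) - e 0%nat * gam k
      - (e 1%nat - e 0%nat) * (INR (S k) * gam k))).
    { intros k. unfold r. apply Rminus_diag_uniq; ring. }
    repeat apply (is_series_minus (K := R_AbsRing) (V := R_NormedModule)).
    - exact G2.
    - now apply (is_series_scal (K := R_AbsRing) (V := R_NormedModule)).
    - now apply (is_series_scal (K := R_AbsRing) (V := R_NormedModule)). }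
  pose proof (Series_correct _ Hc) as HS. apply is_series_incr in HS.
  (* The weight vanishes at index 0, so the value [A 0], which is no coefficient of the series, has
     no influence. *)
  replace (INR 0 * INR (0 - 1) * Rabs (A 1%nat - q * A 0%nat)) with 0 in HS by (simpl; ring).
  rewrite Rminus_0_r in HS.
  set (B := D * dTV h (shift1 h)).
  apply (is_series_scal (K := R_AbsRing) (V := R_NormedModule) B) in HS.
  refine (is_series_Rabs_le _ _ _ _ _ G3 HS).
  intros k. rewrite Rabs_mult. unfold gam. rewrite Rabs_minus_sym.
  replace (S k - 1)%nat with k by lia.
  pose proof (proj2 (second_difference e _ second_difference_e (S k))) as Hr. fold (r (S k)) in Hr.
  replace (INR (S k) * (INR (S k) - 1) / 2 * (D * (2 * dTV h (shift1 h))))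
    with (B * (INR (S k) * INR k)) in Hr by (unfold B; rewrite S_INR; field).
  unfold scal; simpl; unfold mult; simpl (_ * _).
  apply (Rmult_le_compat_l (Rabs (A (S (S k)) - q * A (S k)))) in Hr; [|apply Rabs_pos].
  change (Rabs (A (S (S k)) - q * A (S k)) * Rabs (r (S k)) <=
    B * (INR (S k) * INR k * Rabs (A (S (S k)) - q * A (S k)))).
  lra.
Qed.

End SteinComparison.

(** * The bound *)

Lemma ex_series_bounded (u : nat -> R) B :
  (forall k, 0 <= u k) -> (forall n, fsum n u <= B) -> ex_series u.
Proof.
  intros H0 HB.
  destruct (ex_finite_lim_seq_incr (fun n => fsum n u) B) as [l Hl].
  - intros n. rewrite fsum_S. specialize (H0 n). lra.
  - exact HB.
  - exists l. now apply is_series_fsum.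
Qed.

(* |a(l+1)| <= q |a(l)| + |a(l+1) - q a(l)| is a contraction up to a summable error. *)
Lemma ex_series_Rabs_contraction (a : nat -> R) q :
  0 < q < 1 -> ex_series (fun l => INR l * INR (l - 1) * Rabs (a (S l) - q * a l)) ->
  ex_series (fun k => Rabs (a (S k))).
Proof.
  intros Hq Hc.
  set (w := fun l => INR l * INR (l - 1) * Rabs (a (S l) - q * a l)) in *.
  assert (Hw : forall l, 0 <= w l).
  { intros l. unfold w. pose proof (pos_INR l). pose proof (pos_INR (l - 1)).
    repeat apply Rmult_le_pos; try assumption. apply Rabs_pos. }
  (* The weight [l (l - 1)] is at least 1 only from [l = 2], so the contraction starts at [a 2]. *)
  apply ex_series_incr_1. destruct Hc as [s Hs].
  apply (ex_series_bounded _ ((Rabs (a 2%nat) + s) / (1 - q))); [intros; apply Rabs_pos|].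
  intros n. pose proof (fsum_le_series w (S (S n)) s Hw Hs) as Hws.
  set (y := fun k => Rabs (a (S (S k)))).
  assert (Hy : fsum (S n) y <= y 0%nat + q * fsum n y + s).
  { rewrite fsum_Sl.
    assert (fsum n (fun k => y (S k)) <= fsum n (fun k => q * y k + w (S (S k)))).
    { apply fsum_le; intros k _. unfold y, w.
      assert (H1 : 1 <= INR (S (S k)) * INR (S (S k) - 1)).
      { replace (S (S k) - 1)%nat with (S k) by lia. rewrite !S_INR.
        pose proof (pos_INR k). nra. }
      replace (a (S (S (S k)))) with (q * a (S (S k)) + (a (S (S (S k))) - q * a (S (S k)))) at 1 by ring.
      eapply Rle_trans; [apply Rabs_triang|].
      rewrite Rabs_mult, (Rabs_pos_eq q) by lra.
      pose proof (Rabs_pos (a (S (S (S k))) - q * a (S (S k)))). nra. }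
    rewrite fsum_plus, fsum_scal in H.
    rewrite !fsum_Sl in Hws. pose proof (Hw 0%nat). pose proof (Hw 1%nat). lra. }
  rewrite fsum_S in Hy. unfold y at 2 3 in Hy.
  pose proof (Rabs_pos (a (S (S n)))).
  apply (Rmult_le_reg_r (1 - q)); [lra|].
  replace ((Rabs (a 2%nat) + s) / (1 - q) * (1 - q)) with (Rabs (a 2%nat) + s) by (field; lra).
  fold y. lra.
Qed.

Lemma is_series_sum n (F : nat -> nat -> R) (l : nat -> R) :
  (forall i, (i < n)%nat -> is_series (F i) (l i)) ->
  is_series (fun m => fsum n (fun i => F i m)) (fsum n l).
Proof.
  intros H. apply is_series_fsum.
  apply (is_lim_seq_ext (fun N => fsum n (fun i => fsum N (F i)))).
  - intros; apply fsum_swap.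
  - apply is_lim_seq_fsum. intros; now apply is_series_fsum, H.
Qed.

(** [phi] is the indicator of the optimal set where [h > z]: as both masses are 1, half of [|h - z|]
    sums to the same as the positive part of [h - z]. *)
Lemma dTV_indicator h z c :
  (forall m, 0 <= h m) -> (forall m, 0 <= z m) -> is_series h 1 -> is_series z 1 ->
  let phi := fun m => if Rle_dec (h m) (z m) then 0 else 1 in
  is_series (fun m => phi m * z m) c ->
  is_series (fun m => h m * (phi m - c)) (dTV h z).
Proof.
  intros Hh Hz Hh1 Hz1 phi Hc.
  assert (HS : is_series (fun m => Rabs (h m - z m)) (2 * dTV h z)).
  { unfold dTV. rewrite <- Rmult_assoc, Rinv_r, Rmult_1_l by lra.
    apply Series_correct, ex_series_dist; auto; now exists 1. }
  replace (dTV h z) with (/ 2 * (2 * dTV h z + 1 - 1) + c - c * 1) by field.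
  apply (is_series_ext (fun m => / 2 * (Rabs (h m - z m) + h m - z m) + phi m * z m - c * h m)).
  { intros m. unfold phi, Rabs. apply Rminus_diag_uniq.
    destruct (Rle_dec (h m) (z m)), (Rcase_abs (h m - z m)); try lra; field_simplify; lra. }
  apply (is_series_minus (K := R_AbsRing) (V := R_NormedModule)).
  - apply (is_series_plus (K := R_AbsRing) (V := R_NormedModule)); [|exact Hc].
    apply (is_series_scal (K := R_AbsRing) (V := R_NormedModule) (/ 2)).
    apply (is_series_minus (K := R_AbsRing) (V := R_NormedModule)); [|exact Hz1].
    now apply (is_series_plus (K := R_AbsRing) (V := R_NormedModule)).
  - now apply (is_series_scal (K := R_AbsRing) (V := R_NormedModule) c).
Qed.

Lemma dTV_nb_stein (h A : nat -> R) alpha q mu mu2 :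
  0 < alpha -> 0 < q < 1 ->
  (forall m, 0 <= h m) -> is_series h 1 ->
  (forall m, INR (S m) * h (S m) = conv h (fun k => A (S k)) m) ->
  ex_series (fun k => Rabs (A (S k))) ->
  is_series (fun m => A (S m)) mu -> is_series (fun m => INR m * A (S m)) mu2 ->
  ex_series (fun l => INR l * INR (l - 1) * Rabs (A (S l) - q * A l)) ->
  q * alpha = (1 - q) * mu -> q * (mu + mu2) = mu2 ->
  dTV h (nb_pmf alpha (1 - q)) <= / (alpha * q) * dTV h (shift1 h) *
    Series (fun l => INR l * INR (l - 1) * Rabs (A (S l) - q * A l)).
Proof.
  intros Ha Hq Hh Hh1 Hrec HA Hmu Hmu2 Hc Hmean Hvar.
  set (z := nb_pmf alpha (1 - q)).
  assert (Hz : forall m, 0 < z m) by (intros; apply nb_pmf_pos; lra).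
  assert (Hz0 : forall m, 0 <= z m) by (intros; apply Rlt_le, Hz).
  assert (Hz1 : is_series z 1) by (apply is_series_nb_pmf; lra).
  assert (Hzrec : forall m, INR (S m) * z (S m) = q * (alpha + INR m) * z m).
  { intros m. unfold z. rewrite nb_pmf_S. ring. }
  set (phi := fun m => if Rle_dec (h m) (z m) then 0 else 1).
  assert (Hphi : forall m, 0 <= phi m <= 1) by (intros m; unfold phi; destruct (Rle_dec _ _); lra).
  assert (Hpz : ex_series (fun m => phi m * z m)).
  { apply (ex_series_dominated _ z); [|now exists 1]. intros m.
    specialize (Hphi m). specialize (Hz0 m). rewrite Rabs_pos_eq; nra. }
  destruct Hpz as [c Hpz].
  pose proof (dTV_indicator h z c Hh Hz0 Hh1 Hz1 Hpz) as HT. fold phi in HT.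
  destruct (stein_bounded alpha q z phi c Ha Hq Hz Hzrec Hz1 Hphi Hpz) as [G HG].
  eapply Rle_trans; [apply Rle_abs|].
  apply (stein_comparison h A (stein alpha q z phi c) alpha q mu mu2 G); auto.
  - intros k Hk. now apply (stein_diff_bound alpha q z phi c).
  - eapply is_series_ext; [|exact HT]. intros m. simpl. f_equal.
    symmetry. now apply stein_equation.
Qed.

Theorem theorem3p2 (n : nat) (f : nat -> nat -> R) (a : nat -> nat -> R)
  (Hf_nonneg : forall i m, (i < n)%nat -> 0 <= f i m)
  (Hf_sum : forall i, (i < n)%nat -> is_series (f i) 1)
  (HG : forall i, (i < n)%nat -> exists r, 0 < r /\
     forall z, Rabs z < r ->
       ex_series (fun m => a i (S m) * z ^ m) /\
       is_derive (pgf (f i)) z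
         (pgf (f i) z * Series (fun m => a i (S m) * z ^ m)))
  (Hmu_cv : forall i, (i < n)%nat -> ex_series (fun m => a i (S m)))
  (Hsig_cv : forall i, (i < n)%nat -> ex_series (fun m => INR (S m) * a i (S m)))
  (Hmu2_cv : forall i, (i < n)%nat -> ex_series (fun m => INR m * a i (S m))) :
  let mu := fsum n (fun i => Series (fun m => a i (S m))) in
  let sigma2 := fsum n (fun i => Series (fun m => INR (S m) * a i (S m))) in
  let mu2 := fsum n (fun i => Series (fun m => INR m * a i (S m))) in
  sigma2 > mu ->
  let p := mu / sigma2 in
  let q := 1 - p in
  let alpha := mu ^ 2 / mu2 in
  (forall i, (i < n)%nat ->
     ex_series (fun l => INR l * INR (l - 1) * Rabs (a i (S l) - q * a i l))) ->
  dTV (law_sum f n) (nb_pmf alpha p) <=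
    / (alpha * q) * sqrt (2 / PI)
    * / sqrt (/ 4 + fsum n (fun i => 1 - dTV (f i) (shift1 (f i))))
    * fsum n (fun i =>
        Series (fun l => INR l * INR (l - 1) * Rabs (a i (S l) - q * a i l))).
Proof.
  intros mu sigma2 mu2 Hsm p q alpha Hc.
  assert (Hrec : forall i m, (i < n)%nat ->
      INR (S m) * f i (S m) = conv (f i) (fun k => a i (S k)) m).
  { intros i m Hi. destruct (HG i Hi) as (r & Hr & H).
    apply (pgf_recursion (f i) (a i) r); auto. now exists 1; apply Hf_sum. }
  set (mui := fun i => Series (fun m => a i (S m))).
  assert (Hmui : forall i, (i < n)%nat -> is_series (fun m => a i (S m)) (mui i))
    by (intros; apply Series_correct; auto).
  (* [mui i] is the mean of [f i], hence nonnegative even when individual coefficients are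
     negative. *)
  assert (Hmui0 : forall i, (i < n)%nat -> 0 <= mui i).
  { intros i Hi. apply (is_series_nonneg (fun m => INR (S m) * f i (S m))).
    - intros; apply Rmult_le_pos; [apply pos_INR|auto].
    - apply (is_series_moment (f i) (a i)); auto. }
  assert (Es : sigma2 = mu + mu2).
  { unfold sigma2, mu, mu2. rewrite <- fsum_plus. apply fsum_ext; intros i Hi.
    apply is_series_unique.
    apply (is_series_ext (fun m => a i (S m) + INR m * a i (S m))).
    - intros m. rewrite S_INR. apply Rminus_diag_uniq; ring.
    - apply (is_series_plus (K := R_AbsRing) (V := R_NormedModule)); apply Series_correct; auto. }
  (* If [mu = 0], every summand has mean 0, all coefficients vanish and [sigma2 = 0], against
     [sigma2 > mu]. *)
  assert (Hmu : 0 < mu).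
  { assert (H0 : 0 <= mu) by (apply fsum_nonneg, Hmui0).
    destruct H0 as [H0|H0]; [exact H0|exfalso].
    assert (Hz : forall i, (i < n)%nat -> mui i = 0).
    { clear - H0 Hmui0. unfold mu in H0. fold mui in H0. revert H0 Hmui0.
      induction n as [|k IH]; intros H0 Hp i Hi; [lia|].
      rewrite fsum_S in H0. pose proof (Hp k ltac:(lia)).
      pose proof (fsum_nonneg k mui ltac:(auto with arith)).
      destruct (Nat.eq_dec i k) as [->|]; [lra|]. apply IH; auto with arith; [lra|lia]. }
    enough (sigma2 = 0) by lra.
    apply fsum_0; intros i Hi. rewrite (Series_ext _ (fun m => 0 * a i (S m))).
    - rewrite Series_scal_l. apply Rmult_0_l.
    - intros m. rewrite (zero_mean_coefficients (f i) (a i)); auto; [ring|].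
      rewrite <- (Hz i Hi). auto. }
  assert (Hp : 0 < p < 1).
  { unfold p. split; [apply Rdiv_lt_0_compat; lra|].
    apply (Rmult_lt_reg_r sigma2); [lra|]. unfold Rdiv. rewrite Rmult_assoc, Rinv_l; lra. }
  assert (Hq : 0 < q < 1) by (unfold q; lra).
  assert (Hmu2 : 0 < mu2) by lra.
  assert (Ha : 0 < alpha) by (apply Rdiv_lt_0_compat; [now apply pow_lt|exact Hmu2]).
  set (A := fun k => fsum n (fun i => a i k)).
  set (h := law_sum f n).
  assert (Hh : forall m, 0 <= h m) by (intros; now apply law_sum_nonneg).
  assert (Hh1 : is_series h 1) by now apply is_series_law_sum.
  assert (HcA : is_series (fun l => fsum n (fun i => INR l * INR (l - 1) * Rabs (a i (S l) - q * a i l)))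
    (fsum n (fun i => Series (fun l => INR l * INR (l - 1) * Rabs (a i (S l) - q * a i l))))).
  { apply (is_series_sum n (fun i l => INR l * INR (l - 1) * Rabs (a i (S l) - q * a i l))).
    intros; apply Series_correct; auto. }
  (* Stein's method is run with the summed coefficients [A]; the triangle inequality returns to the
     individual ones. *)
  assert (Hle : forall l, 0 <= INR l * INR (l - 1) * Rabs (A (S l) - q * A l) <=
      fsum n (fun i => INR l * INR (l - 1) * Rabs (a i (S l) - q * a i l))).
  { intros l. assert (0 <= INR l * INR (l - 1)) by (apply Rmult_le_pos; apply pos_INR).
    split; [apply Rmult_le_pos; [assumption|apply Rabs_pos]|].
    rewrite fsum_scal. apply Rmult_le_compat_l; [assumption|].
    unfold A. rewrite <- fsum_scal, <- fsum_minus. apply fsum_abs. }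
  assert (HcA' : ex_series (fun l => INR l * INR (l - 1) * Rabs (A (S l) - q * A l))).
  { eapply ex_series_dominated; [|eexists; exact HcA]. intros l.
    rewrite Rabs_pos_eq; apply Hle. }
  assert (Ep : p = 1 - q) by (unfold q; ring).
  assert (Hps : p * sigma2 = mu) by (unfold p; field; lra).
  eapply Rle_trans.
  { rewrite Ep. apply (dTV_nb_stein h A alpha q mu mu2); auto.
    - now apply law_sum_recursion.
    - now apply (ex_series_Rabs_contraction A q).
    - now apply (is_series_sum n (fun i m => a i (S m))).
    - apply (is_series_ext (fun m => fsum n (fun i => INR m * a i (S m)))).
      + intros m. apply fsum_scal.
      + apply (is_series_sum n (fun i m => INR m * a i (S m))). intros; apply Series_correct; auto.
    (* Both matching conditions come from [q = mu2 / sigma2], [alpha = mu^2 / mu2] and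
       [sigma2 = mu + mu2]. *)
    - rewrite <- Ep. unfold q, alpha, p. rewrite Es. field. lra.
    - unfold q, p. rewrite Es. field. lra. }
  rewrite !Rmult_assoc. apply Rmult_le_compat_l.
  { apply Rlt_le, Rinv_0_lt_compat, Rmult_lt_0_compat; lra. }
  rewrite <- Rmult_assoc. apply Rmult_le_compat.
  - unfold dTV. apply Rmult_le_pos; [lra|].
    apply (is_series_nonneg (fun m => Rabs (h m - shift1 h m))); [intros; apply Rabs_pos|].
    apply Series_correct, ex_series_dist; [exact Hh|intros; now apply shift1_nonneg|now exists 1|].
    exists 1; now apply is_series_shift1.
  - apply (is_series_nonneg (fun l => INR l * INR (l - 1) * Rabs (A (S l) - q * A l)));
      [intros; apply Hle|]. now apply Series_correct.
  - now apply dTV_shift_law_sum.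
  - rewrite <- (is_series_unique _ _ HcA). apply Series_le; [exact Hle|now eexists; exact HcA].
Qed.
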